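(* Let $G=(V,E)$ be a (finite or infinite) regular, non-bipartite, simple, connected graph. Then $$\mu_x^{\mathcal Q}(\delta)\le 10\sqrt{\delta},\qquad 0\le\delta\le 2,\ x\in V.$$ For each $x\in V$ and each integer $t\ge 1$, simple random walk on $G$ satisfies $$0\le p_t(x,x)-\pi(x)\le \frac{18}{\sqrt t}\quad\text{if } t \text{ is even},\qquad |p_t(x,x)-\pi(x)|\le\frac{9}{\sqrt t}\quad\text{if } t\text{ is odd}.$$ Furthermore, when $G$ is finite with $n=|V|$ vertices, $\lambda_k^P\ge -1+\frac{k^2}{100n^2}$ for $1\le k\le n$.
   Context: Graphs are undirected, unweighted and locally finite (every vertex has finite degree $d(x)$). $\pi(x)=d(x)/(2|E|)$, which is $0$ if $G$ is infinite. Simple random walk moves from a vertex to a uniformly random neighbour; $p_t(x,y)$ is the probability that the walk started at $x$ is at $y$ at step $t$. $\ell^2(V,d)$ is the Hilbert space of functions on $V$ with $\langle f,g\rangle_d=\sum_x d(x)f(x)\overline{g(x)}$. The transition operator is $(Pf)(x)=\frac1{d(x)}\sum_{y\sim x}f(y)$, a bounded self-adjoint operator on $\ell^2(V,d)$ with spectrum in $[-1,1]$; $\mathcal Q=I+P$. With $I_{\mathcal Q}$ the spectral projection-valued measure (resolution of identity) of $\mathcal Q$ and $\mathbf e_x=\mathbf 1_x/\sqrt{d(x)}$, the vertex spectral measure is $\mu_x^{\mathcal Q}(\delta)=\langle I_{\mathcal Q}([0,\delta])\mathbf e_x,\mathbf e_x\rangle_d$. When $G$ is finite, $\lambda_1^P\le\lambda_2^P\le\dots\le\lambda_n^P=1$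 are the eigenvalues of $P$ with multiplicity. *)

(* Defs.v *)
From mathcomp Require Import all_boot all_order all_algebra finmap.
From mathcomp Require Import all_classical all_reals all_analysis.
From mathcomp Require Import complex.
Set Implicit Arguments.
Unset Strict Implicit.
Unset Printing Implicit Defensive.
Import Order.TTheory GRing.Theory Num.Theory.
Local Open Scope classical_set_scope.
Local Open Scope ring_scope.
Local Open Scope complex_scope.

Section Graph.
Context {V : choiceType}.
Implicit Types (e : rel V) (x y : V).

Definition simple_graph e : Prop := symmetric e /\ irreflexive e.

Definition neighbors e x : set V := [set y | e x y].

(* [fset_set] is the expected finite set on finite sets and [fset0] otherwise,
   so [degree] and sums over [fset_set (neighbors e x)] are meaningful only for
   locally finite [e]. *)
Definition locally_finite e : Prop := forall x, finite_set (neighbors e x).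

Definition degree e x : nat := #|` fset_set (neighbors e x)|.

Definition regular_graph e : Prop :=
  locally_finite e /\ exists D : nat, forall x, degree e x = D.

Definition connected_graph e : Prop :=
  forall x y, exists2 p : seq V, path e x p & last x p = y.

Definition bipartite e : Prop :=
  exists c : V -> bool, forall x y, e x y -> c x != c y.

Definition edges e : set {fset V} :=
  [set A | exists x y, e x y /\ A = [fset x; y]%fset].

End Graph.

Section RandomWalk.
Context {V : choiceType}.
Implicit Types (e : rel V) (x y : V).

(* The operator P; the scalars are a parameter because it acts both on
   complex-valued functions and on real-valued ones. *)
Definition transition_op (F : fieldType) e (f : V -> F) (x : V) : F :=
  (degree e x)%:R^-1 * \sum_(y <- fset_set (neighbors e x)) f y.

Variable R : realType.

(* p_t(x, y), by conditioning on the first step, which is uniform on the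
   neighbours of [x]. *)
Fixpoint walk_prob e (t : nat) (x y : V) : R :=
  if t is t'.+1 then
    \sum_(z <- fset_set (neighbors e x)) (degree e x)%:R^-1 * walk_prob e t' z y
  else (x == y)%:R.

Definition stationary e x : R :=
  if `[< finite_set [set: V] >] then
    (degree e x)%:R / (2 * #|` fset_set (edges e)|%:R)
  else 0.

End RandomWalk.

Section HilbertSpace.
Context {R : realType} {V : choiceType}.
Implicit Types (e : rel V) (f g : V -> R[i]).

(* l^2(V, d) is weighted by the degrees. *)
Definition l2 e f : Prop :=
  (\esum_(x in [set: V]) ((degree e x)%:R * complex.Re (f x * (f x)^*))%:E < +oo)%E.

(* The unconditional sum of a real family (meaningful if it is summable). *)
Definition real_sum (u : V -> R) : R :=
  fine (\esum_(x in [set: V]) (u^\+ x)%:E)%E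
  - fine (\esum_(x in [set: V]) (u^\- x)%:E)%E.

Definition inner e f g : R[i] :=
  real_sum (fun x => complex.Re ((degree e x)%:R * f x * (g x)^*))
  +i* real_sum (fun x => complex.Im ((degree e x)%:R * f x * (g x)^*)).

(* Operators on l^2(V, d) are total maps on functions, of which only the
   restriction to [l2 e] is considered. *)
Record orthogonal_projection e (T : (V -> R[i]) -> (V -> R[i])) : Prop := {
  oproj_l2 : forall f, l2 e f -> l2 e (T f) ;
  oproj_linear : forall (a : R[i]) f g, l2 e f -> l2 e g ->
    T (fun x => a * f x + g x) =1 (fun x => a * T f x + T g x) ;
  oproj_idem : forall f, l2 e f -> T (T f) =1 T f ;
  oproj_selfadjoint : forall f g, l2 e f -> l2 e g ->
    inner e (T f) g = inner e f (T g) }.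

(* [E] is a projection-valued measure on the Borel sets of the line with
   [A] = \int l dE(l).  Countable additivity of [E] and the integral are
   expressed through the scalar measures [B |-> <E(B) f, f>]; the complex
   measures [B |-> <E(B) f, g>] are obtained from these by polarization.  As the
   right-hand side of the integral identity is finite, the identity function is
   integrable for each of the scalar measures. *)
Record resolution_of_identity e (A : (V -> R[i]) -> (V -> R[i]))
    (E : set (measurableTypeR R) -> (V -> R[i]) -> (V -> R[i])) : Prop := {
  roi_projection : forall B, measurable B -> orthogonal_projection e (E B) ;
  roi_set0 : forall f, l2 e f -> E set0 f =1 (fun=> 0) ;
  roi_setT : forall f, l2 e f -> E setT f =1 f ;
  roi_setI : forall B C, measurable B -> measurable C ->
    forall f, l2 e f -> E (B `&` C) f =1 E B (E C f) ;
  roi_integral : forall f, l2 e f ->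
    exists mu : {measure set (measurableTypeR R) -> \bar R},
      (forall B, measurable B -> mu B = (complex.Re (inner e (E B f) f))%:E) /\
      (\int[mu]_l l%:E = (complex.Re (inner e (A f) f))%:E)%E }.

Definition Q_op e f : V -> R[i] := fun x => f x + transition_op e f x.

Definition unit_vector e (x : V) : V -> R[i] :=
  fun y => if y == x then ((Num.sqrt (degree e x)%:R)^-1)%:C else 0.

(* The real number <E([0, delta]) e_x, e_x>, kept as an element of R[i]. *)
Definition vertex_spectral_measure e
    (E : set (measurableTypeR R) -> (V -> R[i]) -> (V -> R[i]))
    (x : V) (delta : R) : R[i] :=
  inner e (E `[0, delta]%classic (unit_vector e x)) (unit_vector e x).

End HilbertSpace.

Section FiniteGraph.
Context {R : realType} {V : choiceType}.

(* The matrix of P in the basis of indicator functions, for an enumeration [v]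
   of the vertices. *)
Definition transition_mx (e : rel V) (n : nat) (v : 'I_n -> V) : 'M[R]_n :=
  \matrix_(i, j) transition_op e (fun y : V => (y == v j)%:R : R) (v i).

Definition sorted_eigenvalues (n : nat) (M : 'M[R]_n) (lam : seq R) : Prop :=
  sorted <=%R lam /\ char_poly M = \prod_(a <- lam) ('X - a%:P).

End FiniteGraph.

(* Main.v *)
(** Let g be square summable on a connected D-regular graph and s = 1 or -1.  If
    some edge yz has s g(y) g(z) >= 0, then
      g(x)^4 <= 64 |g|^2 <(I + s P) g, g>.
    Indeed, go from x along a geodesic to the nearest vertex y, at distance r,
    where |g| drops below |g(x)| / 2 or which lies on such an edge: by
    Cauchy-Schwarz the energy along the way is at least |g(x)|^2 / (4 r), while
    |g| >= |g(x)| / 2 on the ball of radius r - 1, which has about D r / 3 vertices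
    since neighbourhoods of vertices at distances 0, 3, 6, ... are disjoint.
    For s = 1 such an edge exists because the graph is not bipartite; for s = -1
    it exists if g has a zero or sums to 0.

    Applied to g = I_Q([0, delta]) e_x, for which <Q g, g> <= delta |g|^2, this
    bounds the vertex spectral measure by 8 sqrt(delta); summing over x counts the
    eigenvalues of a finite graph.  For return probabilities, P is replaced by its
    restriction to a ball of radius t, or, in a finite graph, by P minus the
    projection on constants, so that finite-dimensional spectral theory suffices.
    With a_u the u-th moment of the positive (or reflected negative) part of the
    spectral measure at x, g = P^(u/2) e_x gives a_{u+1} <= a_u - a_u^3 / 64,
    hence a_t <= sqrt(32 / t). *)

Require Import Defs.
From mathcomp Require Import all_boot all_order all_algebra finmap.
From mathcomp Require Import all_classical all_reals all_analysis.
From mathcomp Require Import measurable_realfun complex.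
From mathcomp Require Import zify ring lra.
Import Order.TTheory GRing.Theory Num.Theory.
Local Open Scope classical_set_scope.
Local Open Scope ring_scope.
Local Open Scope complex_scope.

Set Implicit Arguments.
Unset Strict Implicit.
Unset Printing Implicit Defensive.

(** * Distances and energy along geodesics *)

Section SeqSums.
Context {R : numDomainType}.

Lemma ler_sum_sub (T : eqType) (s1 s2 : seq T) (F : T -> R) :
  uniq s1 -> {subset s1 <= s2} -> {in s2, forall z, 0 <= F z} ->
  \sum_(z <- s1) F z <= \sum_(z <- s2) F z.
Proof.
elim: s1 s2 => [|a s1 IH] s2 /=.
  by move=> _ _ F0; rewrite big_nil big_seq sumr_ge0.
move=> /andP[as1 us1] s12 F0.
have as2 : a \in s2 by apply: s12; rewrite mem_head.
rewrite big_cons (perm_big _ (perm_to_rem as2)) big_cons lerD2l.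
apply: IH => // [z zs1|z /mem_rem]; last exact: F0.
have : z \in s2 by apply: s12; rewrite inE zs1 orbT.
rewrite (perm_mem (perm_to_rem as2)) inE => /orP[/eqP za|//].
by rewrite -za zs1 in as1.
Qed.

Lemma sumr_pred1_seq (T : eqType) (s : seq T) (x : T) (F : T -> R) :
  uniq s -> \sum_(z <- s) F z * (z == x)%:R = if x \in s then F x else 0.
Proof.
elim: s => [|a s IH] /=; first by rewrite big_nil.
move=> /andP[as' us]; rewrite big_cons IH// inE eq_sym.
case: eqVneq => [->|_]; last by rewrite mulr0 add0r.
by rewrite (negbTE as') mulr1 addr0.
Qed.

End SeqSums.

(** Cauchy-Schwarz against the constant sequence 1: with a = A / m, sum the inequalities 2 a c_i -
    a^2 <= c_i^2. *)
Lemma sqr_le_sum_sqr {R : realFieldType} (m : nat) (c : nat -> R) (A : R) :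
  0 <= A -> A <= \sum_(i < m) c i -> A ^+ 2 <= m%:R * \sum_(i < m) c i ^+ 2.
Proof.
move=> A0 Ale.
case: m Ale => [|m] Ale.
  rewrite big_ord0 in Ale; rewrite mul0r.
  have -> : A = 0 by apply/eqP; rewrite eq_le Ale A0.
  by rewrite expr0n.
have m0 : (0 : R) < m.+1%:R by rewrite ltr0n.
set a := A / m.+1%:R.
have Aa : A = a * m.+1%:R by rewrite /a divfK// gt_eqF.
have a0 : 0 <= a by rewrite divr_ge0// ltW.
have : \sum_(i < m.+1) (2 * a * c i - a ^+ 2) <= \sum_(i < m.+1) c i ^+ 2.
  by apply: ler_sum => i _; have := sqr_ge0 (c i - a); nra.
rewrite big_split /= -mulr_sumr sumr_const card_ord mulNrn -(mulr_natr (a ^+ 2)).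
move: (\sum_(i < _) c i) (\sum_(i < _) c i ^+ 2) Ale => S Q AS.
rewrite Aa in AS *; move: (m.+1%:R : R) m0 AS => M m0 AS H.
have : a * (a * M) <= a * S by rewrite ler_wpM2l.
move=> H2.
have : M * (a ^+2 * M) <= M * Q by rewrite ler_pM2l//; nra.
nra.
Qed.

Section Neighbours.
Context {V : choiceType}.
Variable e : rel V.
Hypothesis finN : locally_finite e.
Hypothesis symE : symmetric e.

Local Notation nbrs x := (fset_set (neighbors e x)).

Lemma mem_nbrs x y : (y \in nbrs x) = e x y.
Proof.
rewrite in_fset_set//; apply/idP/idP; first by move/set_mem.
by move=> h; apply: mem_set.
Qed.

Lemma uniq_nbrs x : uniq (nbrs x).
Proof. exact: fset_uniq. Qed.

Hypothesis connE : connected_graph e.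

(** The distance is the least length of a walk from [x]; dropping the last edge of a shortest walk
    gives the last clause. *)
Lemma graph_distance (x : V) : exists dist : V -> nat,
  [/\ dist x = 0%N, forall y, dist y = 0%N -> y = x,
      forall y z, e y z -> (dist z <= (dist y).+1)%N &
      forall z k, dist z = k.+1 -> exists2 y, e y z & dist y = k].
Proof.
pose P y k := `[< exists p, [/\ path e x p, last x p = y & size p = k] >].
have exP y : exists k, P y k.
  have [p pp lp] := connE x y; exists (size p); apply/asboolP; by exists p.
have Pdist y : P y (ex_minn (exP y)) by case: ex_minnP.
exists (fun y => ex_minn (exP y)); split.
- apply/eqP; rewrite -leqn0; case: ex_minnP => m _ /(_ 0%N); apply.
  by apply/asboolP; exists [::].
- move=> y h; have := Pdist y; rewrite h => /asboolP[p [_ lp sp]].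
  by move: lp; rewrite (size0nil sp).
- move=> y z yz; have /asboolP[p [pp lp sp]] := Pdist y.
  case: (ex_minnP (exP z)) => m _; apply; apply/asboolP.
  by exists (rcons p z); rewrite rcons_path pp lp last_rcons size_rcons sp.
- move=> z k; case: (ex_minnP (exP z)) => m /asboolP[p [pp lp sp]] mn km.
  move: sp; rewrite km; case/lastP: p pp lp => [//|p w].
  rewrite rcons_path last_rcons size_rcons => /andP[pp lw] wz [sp].
  exists (last x p); first by rewrite -wz.
  have Py : P (last x p) k by apply/asboolP; exists p.
  case: ex_minnP => j /asboolP[q [pq lq sq]] /(_ _ Py) jk.
  apply/eqP; rewrite eqn_leq jk -ltnS -km; apply: mn; apply/asboolP.
  by exists (rcons q z); rewrite rcons_path pq lq -{1}wz lw last_rcons size_rcons sq.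
Qed.

Section Geodesics.
Variables (x : V) (dist : V -> nat).
Hypothesis dist0 : forall y, dist y = 0%N -> y = x.
Hypothesis dist_edge : forall y z, e y z -> (dist z <= (dist y).+1)%N.
Hypothesis dist_pred : forall z k, dist z = k.+1 -> exists2 y, e y z & dist y = k.

Lemma geodesic (r : nat) (z : V) : dist z = r -> exists y : nat -> V,
  [/\ y 0%N = x, y r = z, forall i, (i < r)%N -> e (y i) (y i.+1) &
      forall i, (i <= r)%N -> dist (y i) = i].
Proof.
elim: r z => [|r IH] z dz.
  exists (fun=> z); split=> // [|i]; first exact: dist0.
  by rewrite leqn0 => /eqP ->.
have [w wz dw] := dist_pred dz; have [y [y0 yr ye yd]] := IH w dw.
exists (fun i => if (i <= r)%N then y i else z); split => //.
- by rewrite ltnn.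
- move=> i; rewrite ltnS => ir; rewrite ir.
  case: (ltngtP i r) ir => // [ir _|-> _]; first exact: ye.
  by rewrite yr.
- move=> i; case: (leqP i r) => ir; first by rewrite yd.
  by move=> ir1; rewrite dz; apply/eqP; rewrite eqn_leq ir ir1.
Qed.

(* The neighbourhoods of the vertices at distances 0, 3, 6, ... along a geodesic
   are pairwise disjoint. *)
Lemma ball_growth (D r J : nat) (z : V) :
  (forall y, degree e y = D) -> dist z = r -> (3 * J <= r.+1)%N ->
  exists S : seq V, [/\ uniq S, size S = (D * J)%N &
    forall v, v \in S -> (dist v + 2 <= 3 * J)%N].
Proof.
move=> degD dz; have [y [_ _ _ yd]] := geodesic dz.
elim: J => [|J IH] Jr; first by exists [::]; rewrite muln0.
have [|S [uS sS dS]] := IH; first lia.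
have dJ : dist (y (3 * J)%N) = (3 * J)%N by apply: yd; lia.
exists (nbrs (y (3 * J)%N) ++ S); split.
- rewrite cat_uniq uniq_nbrs uS andbT /=; apply/hasPn => v vS /=.
  rewrite mem_nbrs; apply/negP => yv.
  (* A neighbour of [y (3 * J)] is at distance at least 3J - 1, a vertex of [S] at most 3J - 2. *)
  by have := dS _ vS; rewrite symE in yv; have := dist_edge yv; lia.
- by rewrite size_cat sS; have := degD (y (3 * J)%N); rewrite /degree => ->; lia.
- move=> v; rewrite mem_cat => /orP[|/dS]; last by lia.
  by rewrite mem_nbrs => /dist_edge; lia.
Qed.

End Geodesics.

Section PathEnergy.
Context {R : numDomainType}.
Variable q : V -> V -> R.
Hypothesis q_ge0 : forall v z, 0 <= q v z.
Hypothesis q_sym : forall v z, q v z = q z v.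

(** Every edge of the path is seen from both of its ends, whence the factor 2. Injectivity makes the
    predecessor and the successor of a vertex two different neighbours. *)
Lemma path_energy (m : nat) (y : nat -> V) :
  (forall i j, (i <= m)%N -> (j <= m)%N -> y i = y j -> i = j) ->
  (forall i, (i < m)%N -> e (y i) (y i.+1)) ->
  2 * \sum_(i < m) q (y i) (y i.+1) <=
  \sum_(v <- [seq y i | i <- iota 0 m.+1]) \sum_(z <- nbrs v) q v z.
Proof.
move=> yinj ye.
(* [b i] is the contribution of the path edge leaving [y i], [c i] that of the edge entering it;
   each is 0 at the end of the path that lacks such an edge. *)
pose b i := if (i < m)%N then q (y i) (y i.+1) else 0.
pose c i := if i is i'.+1 then q (y i'.+1) (y i') else 0.
have bc i : (i <= m)%N -> b i + c i <= \sum_(z <- nbrs (y i)) q (y i) z.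
  move=> im.
  pose s := (if (i < m)%N then [:: y i.+1] else [::]) ++
            (if i is i'.+1 then [:: y i'] else [::]).
  have -> : b i + c i = \sum_(z <- s) q (y i) z.
    rewrite /b /c /s big_cat/=; congr (_ + _).
      by case: ifP; rewrite ?big_seq1 ?big_nil.
    by case: (i) => [|k]; rewrite ?big_seq1 ?big_nil.
  apply: ler_sum_sub => //.
    rewrite /s; case: ifP => h; case: (i) im h => [|i'] im h //=.
    rewrite inE andbT; apply/eqP => /yinj h'.
    have : i'.+2 = i' by apply: h'; lia.
    lia.
  move=> z; rewrite /s mem_cat mem_nbrs => /orP[].
    by case: ifP => // h; rewrite inE => /eqP ->; exact: ye.
  case: (i) im => // i' im; rewrite inE => /eqP ->.
  by rewrite symE; apply: ye.
rewrite big_map -[iota 0 m.+1]/(index_iota 0 m.+1) big_mkord.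
apply: (@le_trans _ _ (\sum_(i < m.+1) (b i + c i))); last first.
  by apply: ler_sum => i _; apply: bc; rewrite -ltnS.
rewrite big_split/= big_ord_recr [X in _ + X]big_ord_recl /= /b ltnn addr0 add0r.
rewrite mulr_natl mulr2n le_eqVlt; apply/orP; left; apply/eqP; congr (_ + _).
  by apply: eq_bigr => i _; rewrite ltn_ord.
by apply: eq_bigr => i _; rewrite /c /= q_sym.
Qed.

(** Each edge at [x] is counted once at [x] and once at its other end. This handles the case in
    which the geodesic is too short for [ball_growth] to give anything. *)
Lemma star_energy (x : V) : irreflexive e ->
  2 * \sum_(z <- nbrs x) q x z <=
  \sum_(v <- x :: nbrs x) \sum_(z <- nbrs v) q v z.
Proof.
move=> irrE.
rewrite big_cons mulr_natl mulr2n lerD2l !big_seq; apply: ler_sum => z.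
rewrite mem_nbrs => xz.
have -> : q x z = \sum_(v <- [:: x]) q z v by rewrite big_seq1 q_sym.
apply: ler_sum_sub => // v; rewrite inE => /eqP ->.
by rewrite mem_nbrs symE.
Qed.

End PathEnergy.

End Neighbours.

(** * The Gagliardo-Nirenberg inequality on a regular graph *)

Section GagliardoNirenberg.
Context {V : choiceType} {R : realFieldType}.
Variable e : rel V.

Local Notation nbrs x := (fset_set (neighbors e x)).

Lemma sqr_signed_sum (s a b : R) : s ^+ 2 = 1 ->
  (a + s * b) ^+ 2 = a ^+ 2 + b ^+ 2 + 2 * (s * (a * b)).
Proof. by move=> s2; rewrite sqrrD exprMn s2 mul1r -mulr_natr; ring. Qed.

Lemma norm_signed_sum_ge (s a b : R) : s ^+ 2 = 1 -> `|a| - `|b| <= `|a + s * b|.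
Proof.
move=> s2; have s1 : `|s| = 1.
  by apply/eqP; rewrite -(@eqrXn2 _ 2)// -normrX s2 normr1 expr1n.
have := lerB_normD a (s * b); by rewrite normrM s1 mul1r.
Qed.

(* A one-dimensional Gagliardo-Nirenberg inequality,
   |g|_oo^4 <= 64 |g|_2^2 <(I + s P) g, g>, the last two quantities being given
   through upper bounds of their finite partial sums. *)
Lemma gagliardo_nirenberg (D : nat) (s : R) (g : V -> R) (N En : R) (x : V) :
  simple_graph e -> locally_finite e -> (forall y, degree e y = D) ->
  connected_graph e -> s ^+ 2 = 1 ->
  (exists v z, e v z /\ 0 <= s * (g v * g z)) ->
  (forall S, uniq S -> \sum_(v <- S) g v ^+ 2 <= N) ->
  (forall S, uniq S ->
     \sum_(v <- S) \sum_(z <- nbrs v) (g v + s * g z) ^+ 2 <= 2 * (D%:R * En)) ->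
  g x ^+ 4 <= 64 * N * En.
Proof.
move=> [symE irrE] finN degD connE s2 [v0 [z0 [vz0 gvz0]]] HN HE.
have D_gt0 : (0 < D)%N.
  rewrite -(degD v0) /degree.
  by rewrite cardfs_gt0; apply/fset0Pn; exists z0; rewrite mem_nbrs.
have D0 : (0 : R) < D%:R by rewrite ltr0n.
have N0 : 0 <= N by have := HN [::] isT; rewrite big_nil.
pose W := D%:R * En.
have W0 : 0 <= W.
  have := HE [::] isT; rewrite big_nil -/W; lra.
rewrite -/W in HE.
(* The degree is cleared from the energy; the factor [D] this puts on the left is recovered below
   from the number of vertices in a ball. *)
suff : D%:R * g x ^+ 4 <= 64 * N * W.
  have -> : 64 * N * W = D%:R * (64 * N * En) by rewrite /W; ring.
  by rewrite ler_pM2l.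
have gx4 : g x ^+ 4 = `|g x| ^+ 4 by rewrite -[RHS]normrX ger0_norm// exprn_even_ge0.
rewrite gx4; have [a0|a0] := eqVneq `|g x| 0.
  by rewrite a0 expr0n /= mulr0 mulr_ge0// mulr_ge0.
have {a0} : 0 < `|g x| by rewrite lt0r a0 normr_ge0.
set a : R := `|g x| => a0.
pose q v z := (g v + s * g z) ^+ 2.
have q0 v z : 0 <= q v z by rewrite sqr_ge0.
have qC v z : q v z = q z v by rewrite /q !sqr_signed_sum// [g z * _]mulrC; ring.
have [dist [dist_x dist0 dist_edge dist_pred]] := graph_distance connE x.
(* The geodesic ends at the nearest vertex where |g| has halved or which lies on an edge with s g(y)
   g(z) >= 0; such a vertex exists because of [v0]. *)
pose stop y := `|g y| < a / 2 \/ (exists2 z, e y z & 0 <= s * (g y * g z)).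
have [y stopy miny] : exists2 y, stop y & forall w, stop w -> (dist y <= dist w)%N.
  pose P k := `[< exists2 y, stop y & dist y = k >].
  have exP : exists k, P k.
    by exists (dist v0); apply/asboolP; exists v0 => //; right; exists z0.
  case: (ex_minnP exP) => k /asboolP[y sy dy] mink; exists y => // w sw.
  by rewrite dy; apply: mink; apply/asboolP; exists w.
set r := dist y in miny.
have far w : (dist w < r)%N -> a / 2 <= `|g w|.
  move=> wr; rewrite leNgt; apply/negP => ga.
  by have := miny w (or_introl ga); rewrite leqNgt wr.
(* Cauchy-Schwarz along an injective path; the 2 from counting edges at both ends cancels the 2 in
   [HE]. *)
have chain m (p : nat -> V) (A : R) :
    (forall i j, (i <= m)%N -> (j <= m)%N -> p i = p j -> i = j) ->
    (forall i, (i < m)%N -> e (p i) (p i.+1)) -> 0 <= A ->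
    A <= \sum_(i < m) `|g (p i) + s * g (p i.+1)| -> A ^+ 2 <= m%:R * W.
  move=> pinj pe A0 Ale.
  have := sqr_le_sum_sqr (c := fun i => `|g (p i) + s * g (p i.+1)|) A0 Ale.
  move=> /le_trans; apply.
  rewrite ler_wpM2l// -(ler_pM2l (x := 2))//.
  have uS : uniq [seq p i | i <- iota 0 m.+1].
    rewrite map_inj_in_uniq ?iota_uniq// => i j.
    by rewrite !mem_iota !add0n !ltnS /=; exact: pinj.
  apply: le_trans (HE _ uS); apply: le_trans (path_energy finN symE q0 qC pinj pe).
  rewrite ler_pM2l//; apply: ler_sum => i _.
  by rewrite /= real_normK ?num_real.
have [p [p0 pr pe pd]] := geodesic dist0 dist_pred (erefl r : dist y = r).
have pinj i j : (i <= r)%N -> (j <= r)%N -> p i = p j -> i = j.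
  by move=> ir jr pij; rewrite -(pd i)// pij pd.
have sum_p : a - `|g y| <= \sum_(i < r) `|g (p i) + s * g (p i.+1)|.
  apply: le_trans (ler_sum _ (fun i _ => norm_signed_sum_ge _ _ s2)).
  rewrite -(big_mkord xpredT (fun i => `|g (p i)| - `|g (p i.+1)|)).
  rewrite (@telescope_sumr_eq _ 0 r (fun i => - `|g (p i)|))// => [|i _].
    by rewrite p0 pr opprK addrC.
  by rewrite opprK addrC.
have energy : a ^+ 2 <= 4 * (maxn 1 r)%:R * W.
  (* If |g| has halved at [y], the increments along the geodesic sum to at least a / 2. *)
  have [gy|gy] := ltP `|g y| (a / 2).
    have r0 : (0 < r)%N.
      rewrite lt0n; apply/eqP => /dist0 yx.
      by move: gy; rewrite yx -/a; lra.
    have -> : maxn 1 r = r by apply/maxn_idPr.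
    have a20 : 0 <= a / 2 by lra.
    have := chain r p (a / 2) pinj pe a20.
    rewrite expr_div_n.
    by move=> /(_ ltac:(lra)); rewrite -natrX; lra.
  (* Otherwise the path is extended by the edge yz, whose term |g(y) + s g(z)| is at least |g(y)|,
     so that the sum is at least a. *)
  case: stopy => [|[z yz gyz]]; first by rewrite ltNge gy.
  (* [z] is a stopping vertex as well, so it is not nearer than [y]; this keeps the extended path
     injective. *)
  have rz : (r <= dist z)%N.
    by apply: miny; right; exists y; [rewrite symE | rewrite [g z * _]mulrC].
  pose p' i := if (i <= r)%N then p i else z.
  have p'inj i j : (i <= r.+1)%N -> (j <= r.+1)%N -> p' i = p' j -> i = j.
    have nz k : (k <= r)%N -> p k <> z.
      move=> kr pkz; have dk := pd k kr; rewrite pkz in dk.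
      have kr' : k = r by apply/eqP; rewrite eqn_leq kr -dk.
      by move: pkz; rewrite kr' pr => yz'; rewrite -yz' irrE in yz.
    have above_r k : (r < k)%N -> (k <= r.+1)%N -> k = r.+1.
      by move=> h1 h2; apply/eqP; rewrite eqn_leq h1 h2.
    rewrite /p' => ir jr; case: (leqP i r) => hi; case: (leqP j r) => hj.
    - exact: pinj.
    - by move/nz => /(_ hi).
    - by move/esym/nz => /(_ hj).
    - by rewrite (above_r i)// (above_r j).
  have p'e i : (i < r.+1)%N -> e (p' i) (p' i.+1).
    rewrite /p' ltnS => ir; rewrite ir; case: (ltngtP i r) ir => // [ir _|-> _].
      exact: pe.
    by rewrite pr.
  have gygz : `|g y| <= `|g y + s * g z|.
    rewrite -(ler_pXn2r (n := 2)) ?nnegrE// !real_normK ?num_real//.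
    by rewrite sqr_signed_sum//; have := sqr_ge0 (g z); lra.
  have := chain r.+1 p' a p'inj p'e (ltW a0).
  have p'r : p' r = y by rewrite /p' leqnn pr.
  have p'r1 : p' r.+1 = z by rewrite /p' ltnn.
  rewrite big_ord_recr /= p'r p'r1.
  have -> : \sum_(i < r) `|g (p' i) + s * g (p' i.+1)| =
            \sum_(i < r) `|g (p i) + s * g (p i.+1)|.
    by apply: eq_bigr => i _; rewrite /p' ltn_ord (ltnW (ltn_ord i)).
  move=> /(_ ltac:(lra)) => h; apply: le_trans h _.
  rewrite -natrM ler_wpM2r// ler_nat.
  by have -> // : forall k, (k.+1 <= 4 * maxn 1 k)%N by clear; lia.
(* For r <= 1 the factor [D] comes from the neighbours of [x]: the [k] of them with |g| >= a / 2
   contribute to [N], each of the others contributes at least a^2 / 4 to the energy. One of the two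
   kinds makes up at least half of them. *)
have [r1|r2] := leqP r 1.
  have {}energy : a ^+ 2 <= 4 * W.
    by move: energy; rewrite (_ : maxn 1 r = 1%N) ?mulr1//; exact/maxn_idPl.
  pose big z := a / 2 <= `|g z|.
  pose k := count big (nbrs x).
  have kD : (k <= D)%N by rewrite -(degD x) /degree count_size.
  have HNk : a ^+ 2 + k%:R * (a ^+ 2 / 4) <= N.
    have uS : uniq (x :: [seq z <- nbrs x | big z]).
      by rewrite /= mem_filter mem_nbrs// irrE andbF filter_uniq// uniq_nbrs.
    apply: le_trans (HN _ uS); rewrite big_cons; apply: lerD.
      by rewrite /= real_normK ?num_real.
    rewrite big_filter /k -sum1_count natr_sum mulr_suml; apply: ler_sum => z bz.
    have : (a / 2) ^+ 2 <= `|g z| ^+ 2 by rewrite ler_pXn2r// nnegrE; lra.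
    by rewrite real_normK ?num_real// expr_div_n -natrX mul1r.
  have HWk : (D - k)%N%:R * (a ^+ 2 / 4) <= W.
    have uS : uniq (x :: nbrs x) by rewrite /= mem_nbrs// irrE uniq_nbrs.
    have := le_trans (star_energy finN symE q0 qC x irrE) (HE _ uS).
    rewrite ler_pM2l//; apply: le_trans.
    have -> : (D - k = count (predC big) (nbrs x))%N.
      by rewrite -(degD x) /degree -(count_predC big) addKn.
    rewrite (bigID big) /= -[X in X <= _]add0r; apply: lerD.
      by apply: sumr_ge0 => z _; exact: q0.
    rewrite -sum1_count natr_sum mulr_suml; apply: ler_sum => z.
    rewrite /= /big -ltNge => bz; rewrite mul1r.
    have h : a / 2 <= `|g x + s * g z|.
      by apply: le_trans (norm_signed_sum_ge _ _ s2); rewrite -/a; lra.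
    have : (a / 2) ^+ 2 <= `|g x + s * g z| ^+ 2 by rewrite ler_pXn2r// nnegrE; lra.
    by rewrite real_normK ?num_real// expr_div_n -natrX.
  have Dk : (D - k)%N%:R = D%:R - k%:R :> R by rewrite natrB.
  rewrite Dk in HWk.
  have k0 : (0 : R) <= k%:R by [].
  have -> : a ^+ 4 = a ^+ 2 * a ^+ 2 by rewrite -exprD.
  move: (a ^+ 2) (sqr_ge0 a) energy HNk HWk => b b0 energy HNk HWk.
  have [h|h] := leP (D%:R : R) (2 * k%:R).
    have h1 : D%:R * (b / 8) <= N by nra.
    have : D%:R * (b / 8) * (b / 4) <= N * W.
      by apply: ler_pM => //; [nra|lra|lra].
    by nra.
  have h1 : b <= N by nra.
  have h2 : D%:R * (b / 8) <= W by nra.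
  have : b * (D%:R * (b / 8)) <= N * W.
    by apply: ler_pM => //; nra.
  by nra.
have mr : maxn 1 r = r by apply/maxn_idPr/ltnW.
rewrite mr in energy.
(* Since 3J <= r + 1, the D J vertices found below are at distance less than [r], so |g| >= a / 2
   there. The constant 64 is the product of 4 from [energy], 4 from (a / 2)^2 and 4 from r <= 4J. *)
pose J := (r.+1 %/ 3)%N.
have J3 : (3 * J <= r.+1)%N by rewrite /J mulnC leq_trunc_div.
have J4 : (r <= 4 * J)%N.
  by have /(_ r r2) : forall k, (1 < k)%N -> (k <= 4 * (k.+1 %/ 3))%N by clear; lia.
have [S [uS sS dS]] :=
  ball_growth finN symE dist0 dist_edge dist_pred degD (erefl r : dist y = r) J3.
have HNJ : D%:R * J%:R * (a ^+ 2 / 4) <= N.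
  apply: le_trans (HN _ uS); rewrite -natrM -sS -sum1_size natr_sum mulr_suml !big_seq.
  apply: ler_sum => v vS; rewrite mul1r.
  have : (a / 2) ^+ 2 <= `|g v| ^+ 2.
    rewrite ler_pXn2r ?nnegrE ?normr_ge0//; last by lra.
    by apply: far; have := leq_trans (dS v vS) J3; rewrite addn2 ltnS.
  by rewrite real_normK ?num_real// expr_div_n -natrX.
have r0 : (0 : R) < r%:R by rewrite ltr0n ltnW.
have rJ : r%:R <= 4 * J%:R :> R by rewrite -natrM ler_nat.
have -> : a ^+ 4 = a ^+ 2 * a ^+ 2 by rewrite -exprD.
move: (a ^+ 2) (sqr_ge0 a) energy HNJ => b b0 energy HNJ.
rewrite -(ler_pM2l r0).
have h1 : r%:R * (D%:R * b) <= 4 * J%:R * (D%:R * b).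
  by rewrite ler_wpM2r// mulr_ge0// ltW.
have h2 : r%:R * (D%:R * b) * b <= 16 * N * b by rewrite ler_wpM2r//; nra.
have h3 : 16 * N * b <= 16 * N * (4 * r%:R * W) by rewrite ler_wpM2l// mulr_ge0.
nra.
Qed.

End GagliardoNirenberg.

(** * Spectral theory of symmetric matrices *)

Lemma char_poly_conj (F : fieldType) (n : nat) (P B : 'M[F]_n) :
  P \in unitmx -> char_poly (invmx P *m B *m P) = char_poly B.
Proof.
move=> uP.
have QP : map_mx polyC (invmx P) *m map_mx polyC P = 1%:M.
  by rewrite -map_mxM mulVmx// map_mx1.
have -> : char_poly (invmx P *m B *m P) =
    \det (map_mx polyC (invmx P) *m char_poly_mx B *m map_mx polyC P).
  rewrite /char_poly /char_poly_mx mulmxBr mulmxBl !map_mxM; congr (\det (_ - _)).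
  by rewrite -mulmxA mul_scalar_mx -scalemxAr QP scalemx1.
by rewrite !det_mulmx mulrC mulrA [\det (map_mx _ P) * _]mulrC -det_mulmx QP det1 mul1r.
Qed.

(** The weight [w x k] is the squared modulus of the coordinate [x] of a unit eigenvector for
    [lam k], that is, the mass at [lam k] of the spectral measure at [x]. The matrix is diagonalized
    by a unitary matrix over [R[i]], and the identities are pulled back along the injection of
    [R]. *)
Lemma symmetric_spectral_measure (R : rcfType) (n : nat) (A : 'M[R]_n.+1) :
  A^T = A -> exists (lam : 'I_n.+1 -> R) (w : 'I_n.+1 -> 'I_n.+1 -> R),
  [/\ forall x k, 0 <= w x k,
      forall k, \sum_x w x k = 1,
      forall p x, horner_mx A p x x = \sum_k w x k * p.[lam k] &
      char_poly A = \prod_k ('X - (lam k)%:P)].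
Proof.
move=> symA.
pose f : {rmorphism R -> R[i]} := real_complex R.
have fE a : f a = a%:C by [].
pose AC := map_mx f A.
have ACreal : AC \is a mxOver Num.real.
  by apply/mxOverP => i j; rewrite mxE complex_real.
have ACsym : AC \is symmetricmx.
  by apply/is_hermitianmxP; rewrite expr0 scale1r map_mx_id// map_trmx symA.
have ACherm := realsym_hermsym ACsym ACreal.
have /orthomx_spectralP ACE := hermitian_normalmx ACherm.
have spR := hermitian_spectral_diag_real ACherm.
move: (spectralmx AC) (spectral_unitarymx AC) (spectral_diag AC) ACE spR => P Pu sp ACE spR.
have uP := unitarymx_unit Pu.
pose lam k := complex.Re (sp 0 k).
have lamE k : f (lam k) = sp 0 k.
  have /mxOverP/(_ 0 k) := spR; rewrite /lam fE.
  by rewrite complexRe => /Creal_ReP.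
pose w x k := complex.Re (`|P k x| ^+ 2).
have wE x k : f (w x k) = `|P k x| ^+ 2.
  rewrite /w fE complexRe; apply/Creal_ReP.
  by rewrite rpredX// normr_real.
have finj : injective f by move=> a b [].
exists lam, w; split.
- move=> x k; have : 0 <= f (w x k) by rewrite wE exprn_ge0.
  by rewrite fE ler0c.
- move=> k; apply: finj; rewrite rmorph_sum rmorph1.
  have /unitarymxP/matrixP/(_ k k) := Pu; rewrite !mxE eqxx mulr1n => <-.
  by apply: eq_bigr => x _; rewrite wE normCK !mxE.
- move=> p x; apply: finj.
  have -> : f (horner_mx A p x x) = map_mx f (horner_mx A p) x x by rewrite mxE.
  rewrite map_horner_mx -/AC ACE -[X in _ *m _ *m X]invmxK.
  have uQ : invmx P \is a GRing.unit.
    by rewrite -[_ \is a _]/(invmx P \in unitmx) unitmx_inv.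
  rewrite horner_mx_uconj// invmxK horner_mx_diag invmx_unitary// mxE rmorph_sum.
  apply: eq_bigr => k _; rewrite mul_mx_diag !mxE rmorphM /= wE normCK.
  rewrite -lamE horner_map. by rewrite mulrAC [_ * P k x]mulrC.
- apply: (map_poly_inj f); rewrite map_char_poly -/AC ACE char_poly_conj//.
  rewrite char_poly_trig ?diag_mx_is_trig// rmorph_prod; apply: eq_bigr => k _.
  by rewrite rmorphB /= map_polyX map_polyC /= !mxE eqxx mulr1n lamE.
Qed.

(** Newton interpolation; through it [horner_mx] gives access to arbitrary functions of a matrix,
    the spectrum being finite. *)
Lemma polynomial_interpolation (F : fieldType) (s : seq F) (phi : F -> F) :
  exists p : {poly F}, {in s, forall a, p.[a] = phi a}.
Proof.
elim: s => [|a s [p IH]]; first by exists 0.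
have [as_|as_] := boolP (a \in s).
  by exists p => b; rewrite inE => /orP[/eqP ->|/IH//]; exact: IH.
pose q : {poly F} := \prod_(b <- s) ('X - b%:P).
have qa : q.[a] != 0 by rewrite -/(root q a) root_prod_XsubC.
exists (p + ((phi a - p.[a]) / q.[a]) *: q) => b; rewrite inE !hornerE.
move=> /orP[/eqP ->|bs]; first by rewrite divfK// addrC subrK.
have : root q b by rewrite root_prod_XsubC.
by move=> /rootP ->; rewrite mulr0 addr0 IH.
Qed.

(** * Decay of moments under a Nash inequality *)

Section Decay.
Context {R : rcfType} {I : finType}.
Variables (w lam : I -> R) (C : R).
Hypothesis C_gt0 : 0 < C.
Hypothesis w_ge0 : forall k, 0 <= w k.
Hypothesis nash : forall phi : R -> R, phi 0 = 0 ->
  (\sum_k w k * phi (lam k)) ^+ 4 <=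
  C * (\sum_k w k * phi (lam k) ^+ 2) * (\sum_k w k * (phi (lam k) ^+ 2 * (1 - lam k))).

(** For the indicator of [lam k], whose total mass is W > 0, the hypothesis reads W^4 <= C W^2 (1 -
    lam k). It is admissible because [lam k] is not 0. *)
Lemma nash_support_lt1 k : 0 < w k -> lam k != 0 -> lam k < 1.
Proof.
move=> wk lk; rewrite ltNge; apply/negP => l1.
have := nash (phi := fun l => (l == lam k)%:R).
rewrite eq_sym (negbTE lk) => /(_ erefl).
pose W := \sum_j w j * (lam j == lam k)%:R.
have -> : \sum_j w j * (lam j == lam k)%:R ^+ 2 = W.
  by apply: eq_bigr => j _; case: eqP; rewrite ?expr1n ?expr0n.
have -> : \sum_j w j * ((lam j == lam k)%:R ^+ 2 * (1 - lam j)) = W * (1 - lam k).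
  rewrite /W mulr_suml; apply: eq_bigr => j _.
  by case: eqP => [->|_]; rewrite ?expr1n ?mul1r ?mulr1// expr0n !mul0r mulr0 mul0r.
rewrite -/W.
have W0 : 0 < W.
  rewrite /W (bigD1 k)//= eqxx mulr1; apply: ltr_pwDl => //.
  by apply: sumr_ge0 => j _; rewrite mulr_ge0.
have h4 : 0 < W ^+ 4 by rewrite exprn_gt0.
have h2 : 0 <= C * W * W by rewrite !mulr_ge0// ltW.
have : C * W * W * (lam k - 1) >= 0 by rewrite mulr_ge0// subr_ge0.
nra.
Qed.

Let a (t : nat) := \sum_(k | 0 < lam k) w k * lam k ^+ t.

Lemma power_sum_ge0 t : 0 <= a t.
Proof.
by apply: sumr_ge0 => k lk; rewrite mulr_ge0// exprn_ge0// ltW.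
Qed.

Lemma power_term_le (u : nat) k : 0 < lam k -> w k * lam k ^+ u.+1 <= w k * lam k ^+ u.
Proof.
move=> lk; have [w0|w0] := eqVneq (w k) 0; first by rewrite w0 !mul0r.
rewrite ler_wpM2l// exprSr ler_piMr ?exprn_ge0 ?ltW//.
by apply: nash_support_lt1; [rewrite lt0r w0 w_ge0 | rewrite gt_eqF].
Qed.

(** The test function is l^(u/2) on l > 0: its square integrates to a_u, its energy is a_u -
    a_{u+1}, and its integral is at least a_u because the support lies in l <= 1. *)
Lemma power_sum_step u : a u ^+ 4 <= C * a u * (a u - a u.+1).
Proof.
pose phi (l : R) : R := if 0 < l then Num.sqrt l ^+ u else 0.
have phi2 l : phi l ^+ 2 = if 0 < l then l ^+ u else 0.
  rewrite /phi; case: ifP => l0; last by rewrite expr0n.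
  by rewrite -exprM mulnC exprM sqr_sqrtr// ltW.
have phi0 : phi 0 = 0 by rewrite /phi ltxx.
have := nash phi0.
have -> : \sum_k w k * phi (lam k) ^+ 2 = a u.
  rewrite /a [RHS]big_mkcond; apply: eq_bigr => k _.
  by rewrite phi2; case: ifP; rewrite ?mulr0.
have -> : \sum_k w k * (phi (lam k) ^+ 2 * (1 - lam k)) = a u - a u.+1.
  rewrite /a -sumrB [RHS]big_mkcond; apply: eq_bigr => k _.
  by rewrite phi2; case: ifP; rewrite ?mul0r ?mulr0// exprSr => _; ring.
apply: le_trans; rewrite lerXn2r ?nnegrE ?power_sum_ge0//.
  apply: sumr_ge0 => k _; rewrite mulr_ge0// /phi.
  by case: ifP => _; rewrite ?exprn_ge0 ?sqrtr_ge0 ?lexx.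
rewrite /a big_mkcond; apply: ler_sum => k _; rewrite /phi; case: ifP => lk.
  have [->|w0] := eqVneq (w k) 0; first by rewrite !mul0r.
  have l1 : lam k <= 1.
    by apply/ltW/nash_support_lt1; [rewrite lt0r w0 w_ge0 | rewrite gt_eqF].
  rewrite ler_wpM2l// lerXn2r ?nnegrE ?sqrtr_ge0 ?(ltW lk)//.
  rewrite -[X in X <= _](sqr_sqrtr (ltW lk)) expr2 ler_piMr ?sqrtr_ge0//.
  by rewrite -sqrtr1 ler_wsqrtr.
by rewrite mulr0.
Qed.

(* [1 / a^2] increases by at least [2 / C] at each step, because
   [a_{u+1} <= a_u - a_u^3 / C]. *)
Lemma power_sum_decay t : 2 * t%:R * a t ^+ 2 <= C.
Proof.
elim: t => [|u IH]; first by rewrite mulr0 mul0r ltW.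
have ab : a u.+1 <= a u by apply: ler_sum => k lk; exact: power_term_le.
have := power_sum_step u; have := power_sum_ge0 u.+1.
move: IH ab; rewrite -[u.+1%:R]natr1; have u0 : (0 : R) <= u%:R by [].
move: (a u.+1) (a u) (power_sum_ge0 u) u0 => b x x0; move: u%:R => U U0 IH bx b0 step.
have [xz|xn] := eqVneq x 0.
  have -> : b = 0 by lra.
  by rewrite expr0n mulr0 ltW.
have {xn}x0 : 0 < x by rewrite lt0r xn.
(* In terms of y = a_u^2 / C, the recursion is a_{u+1} <= a_u (1 - y) and the induction hypothesis
   is 2 u y <= 1. *)
pose y := x ^+ 2 / C.
have xC : x ^+ 2 = C * y by rewrite /y mulrC divfK// gt_eqF.
have y0 : 0 <= y by rewrite divr_ge0 ?sqr_ge0// ltW.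
have byx : b <= x * (1 - y).
  have : C * x * (x * y) <= C * x * (x - b).
    apply: le_trans step; rewrite le_eqVlt; apply/orP; left; apply/eqP.
    have -> : C * x * (x * y) = x ^+ 2 * (C * y) by ring.
    by rewrite -xC; ring.
  rewrite ler_pM2l ?mulr_gt0//; lra.
have y1 : 0 <= 1 - y by rewrite -(pmulr_rge0 _ x0); exact: le_trans byx.
have b2 : b ^+ 2 <= C * y * (1 - y) ^+ 2.
  by rewrite -xC -exprMn lerXn2r ?nnegrE// mulr_ge0// ltW.
have h1 : 2 * (U + 1) * b ^+ 2 <= 2 * (U + 1) * (C * y * (1 - y) ^+ 2).
  by rewrite ler_wpM2l//; lra.
have h2 : 2 * U * x ^+ 2 * (1 - y) ^+ 2 <= C * (1 - y) ^+ 2.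
  by rewrite ler_wpM2r// sqr_ge0.
rewrite xC in h2.
(* The induction closes because 1 - (1 + 2y) (1 - y)^2 = y^2 (3 - 2y). *)
have h3 : 0 <= C * (y ^+ 2 * (3 - 2 * y)).
  by rewrite mulr_ge0 ?(ltW C_gt0)// mulr_ge0 ?sqr_ge0//; lra.
nra.
Qed.

End Decay.

(** * Restriction to finitely many vertices *)

Section FiniteSupport.
Context {V : choiceType} {R : realFieldType}.
Variables (e : rel V) (D : nat).
Hypothesis symE : symmetric e.
Hypothesis finN : locally_finite e.
Hypothesis degD : forall y, degree e y = D.

Local Notation nbrs x := (fset_set (neighbors e x)).

Lemma eq_sum_support (S B : seq V) (F : V -> R) : uniq S -> uniq B ->
  {subset B <= S} -> (forall y, y \notin B -> F y = 0) ->
  \sum_(y <- S) F y = \sum_(y <- B) F y.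
Proof.
move=> uS uB BS F0; rewrite (bigID (mem B)) /= [X in _ + X]big1 ?addr0; last first.
  by move=> y; exact: F0.
rewrite -big_filter; apply: perm_big; apply: uniq_perm => //; first exact: filter_uniq.
by move=> y; rewrite mem_filter /=; case: (boolP (y \in B)) => //= /BS.
Qed.

(** After exchanging the sums, a vertex [z] is counted once for each of its neighbours in [S], hence
    at most [D] times. *)
Lemma sum_neighbours_le (f : V -> R) (M : R) (S : seq V) :
  (forall y, 0 <= f y) -> (forall T, uniq T -> \sum_(y <- T) f y <= M) ->
  uniq S -> \sum_(v <- S) \sum_(z <- nbrs v) f z <= D%:R * M.
Proof.
move=> f0 fM uS.
pose T := undup (flatten [seq enum_fset (nbrs v) | v <- S]).
have uT : uniq T by rewrite undup_uniq.
apply: (@le_trans _ _ (\sum_(v <- S) \sum_(z <- T) (e v z)%:R * f z)).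
  rewrite !big_seq; apply: ler_sum => v vS.
  have -> : \sum_(z <- T) (e v z)%:R * f z = \sum_(z <- [seq z <- T | e v z]) f z.
    rewrite big_filter [RHS]big_mkcond; apply: eq_bigr => z _.
    by case: (e v z); rewrite ?mul1r ?mul0r.
  apply: ler_sum_sub => //.
  move=> z zv; rewrite mem_filter; move: (zv); rewrite mem_nbrs// => ->.
  rewrite mem_undup; apply/flattenP; exists (enum_fset (nbrs v)) => //.
  by apply/mapP; exists v.
rewrite exchange_big /=; apply: (@le_trans _ _ (\sum_(z <- T) D%:R * f z)).
  apply: ler_sum => z _; rewrite -mulr_suml ler_wpM2r//.
  rewrite -natr_sum ler_nat.
  have -> : (\sum_(v <- S) e v z = size [seq v <- S | e v z])%N.
    by rewrite size_filter -sum1_count [RHS]big_mkcond; apply: eq_bigr => v _; case: (e v z).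
  rewrite -(degD z) /degree; apply: uniq_leq_size; first exact: filter_uniq.
  by move=> v; rewrite mem_filter mem_nbrs// symE => /andP[].
by rewrite -mulr_sumr ler_wpM2l// fM.
Qed.

(** Supplies the two bounds that [gagliardo_nirenberg] asks for. Enlarging [S] to contain [B] adds
    only nonnegative terms; then the square is expanded and the terms g(z)^2 are bounded by
    [sum_neighbours_le]. *)
Lemma finite_support_energy (s : R) (B : seq V) (g : V -> R) : s ^+ 2 = 1 ->
  uniq B -> (forall y, y \notin B -> g y = 0) ->
  let N := \sum_(y <- B) g y ^+ 2 in
  (forall S, uniq S -> \sum_(v <- S) g v ^+ 2 <= N) /\
  (forall S, uniq S ->
     \sum_(v <- S) \sum_(z <- nbrs v) (g v + s * g z) ^+ 2 <=
     2 * (D%:R * N + s * \sum_(v <- B) g v * \sum_(z <- nbrs v) g z)).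
Proof.
move=> s2 uB gB N.
pose ext S := undup (S ++ B).
have uext S : uniq (ext S) by rewrite undup_uniq.
have subS S : {subset S <= ext S} by move=> y yS; rewrite mem_undup mem_cat yS.
have subB S : {subset B <= ext S} by move=> y yS; rewrite mem_undup mem_cat yS orbT.
have HN S : uniq S -> \sum_(v <- S) g v ^+ 2 <= N.
  move=> uS; rewrite /N -(eq_sum_support (uext S) uB (subB S)); last first.
    by move=> y /gB ->; rewrite expr0n.
  by apply: ler_sum_sub => // y _; rewrite sqr_ge0.
split=> // S uS.
apply: (@le_trans _ _ (\sum_(v <- ext S) \sum_(z <- nbrs v) (g v + s * g z) ^+ 2)).
  apply: ler_sum_sub => // v _; by apply: sumr_ge0 => z _; rewrite sqr_ge0.
have -> : \sum_(v <- ext S) \sum_(z <- nbrs v) (g v + s * g z) ^+ 2 =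
    \sum_(v <- ext S) D%:R * g v ^+ 2 + \sum_(v <- ext S) \sum_(z <- nbrs v) g z ^+ 2
    + 2 * s * \sum_(v <- ext S) g v * \sum_(z <- nbrs v) g z.
  rewrite mulr_sumr -!big_split /=; apply: eq_bigr => v _.
  under eq_bigr do rewrite sqr_signed_sum//.
  rewrite !big_split /= big_const_seq count_predT iter_addr_0.
  have -> : size (nbrs v) = D by rewrite -(degD v).
  rewrite -(mulr_natl (g v ^+ 2)); congr (_ + _).
  by rewrite -!mulr_sumr; ring.
rewrite -mulr_sumr (eq_sum_support (uext S) uB (subB S)); last first.
  by move=> y /gB ->; rewrite expr0n.
rewrite [X in 2 * s * X](eq_sum_support (uext S) uB (subB S)); last first.
  by move=> y /gB ->; rewrite mul0r.
rewrite -/N; have := sum_neighbours_le (fun y => sqr_ge0 (g y)) HN (uext S).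
lra.
Qed.

End FiniteSupport.

(** * The transition matrix on finitely many vertices *)

Section TransitionMatrix.
Context {V : choiceType} {R : realType}.
Variables (e : rel V) (D : nat).
Hypothesis simple_e : simple_graph e.
Hypothesis finN : locally_finite e.
Hypothesis degD : forall y, degree e y = D.
Hypothesis D_gt0 : (0 < D)%N.

Local Notation nbrs x := (fset_set (neighbors e x)).

Variables (n : nat) (v : 'I_n -> V).
Hypothesis v_inj : injective v.

Local Notation M := (transition_mx e v : 'M[R]_n).

Lemma transition_mxE i j : M i j = D%:R^-1 * (e (v i) (v j))%:R.
Proof.
rewrite mxE /transition_op degD; congr (_ * _).
rewrite (eq_bigr (fun y => 1 * (y == v j)%:R)); last by move=> y _; rewrite mul1r.
rewrite sumr_pred1_seq ?uniq_nbrs// mem_nbrs//.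
by case: (e _ _).
Qed.

Lemma transition_mx_sym : M^T = M.
Proof.
by apply/matrixP => i j; rewrite mxE !transition_mxE simple_e.1.
Qed.

Definition extend_vec (h : 'I_n -> R) (y : V) : R := \sum_i h i * (y == v i)%:R.

Lemma extend_vecE h i : extend_vec h (v i) = h i.
Proof.
rewrite /extend_vec (bigD1 i)//= eqxx mulr1 big1 ?addr0// => j ji.
by rewrite (inj_eq v_inj) eq_sym (negbTE ji) mulr0.
Qed.

Lemma extend_vec_out h y : (forall i, y != v i) -> extend_vec h y = 0.
Proof. by move=> yv; rewrite /extend_vec big1// => i _; rewrite (negbTE (yv i)) mulr0. Qed.

(** The matrix is the compression of P to functions supported on the range of [v]. *)
Lemma sum_neighbours_extend h i :
  \sum_(z <- nbrs (v i)) extend_vec h z = D%:R * \sum_j M i j * h j.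
Proof.
rewrite /extend_vec exchange_big mulr_sumr; apply: eq_bigr => j _.
rewrite (sumr_pred1_seq _ (fun=> h j)) ?uniq_nbrs// mem_nbrs// transition_mxE.
rewrite !mulrA mulfV ?pnatr_eq0 -?lt0n// mul1r.
by case: (e _ _); rewrite ?mul1r ?mul0r.
Qed.

Lemma matrix_gagliardo_nirenberg (s : R) (h : 'I_n -> R) (i : 'I_n) :
  connected_graph e -> s ^+ 2 = 1 ->
  (exists y z, e y z /\ 0 <= s * (extend_vec h y * extend_vec h z)) ->
  h i ^+ 4 <= 64 * (\sum_j h j ^+ 2) * (\sum_j h j * (h j + s * \sum_k M j k * h k)).
Proof.
move=> connE s2 bad.
pose g := extend_vec h; pose B := [seq v j | j <- enum 'I_n].
have uB : uniq B by rewrite map_inj_uniq ?enum_uniq.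
have gB y : y \notin B -> g y = 0.
  move=> yB; apply: extend_vec_out => j; apply: contraNneq yB => ->.
  by rewrite map_f// mem_enum.
have sumB (F : V -> R) : \sum_(y <- B) F y = \sum_j F (v j).
  by rewrite big_map big_enum.
have [HN HE] := finite_support_energy simple_e.1 finN degD s2 uB gB.
move: HN HE; rewrite !sumB.
have -> : \sum_j g (v j) ^+ 2 = \sum_j h j ^+ 2.
  by apply: eq_bigr => j _; rewrite /g extend_vecE.
have -> : \sum_j g (v j) * \sum_(z <- nbrs (v j)) g z =
          D%:R * \sum_j h j * \sum_k M j k * h k.
  rewrite mulr_sumr; apply: eq_bigr => j _.
  by rewrite /g sum_neighbours_extend extend_vecE mulrCA.
move=> HN HE; rewrite -(extend_vecE h i).
apply: (gagliardo_nirenberg (D := D) (s := s) _ simple_e) => // S uS.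
apply: le_trans (HE S uS) _; rewrite le_eqVlt; apply/orP; left; apply/eqP.
congr (2 * _); rewrite mulrCA -mulrDr; congr (_ * _).
rewrite mulr_sumr -big_split /=; apply: eq_bigr => j _; ring.
Qed.

End TransitionMatrix.

(** * Functions of a symmetric matrix *)

Section SpectralCalculus.
Context {R : rcfType} {n : nat}.
Variable A : 'M[R]_n.+1.
Hypothesis symA : A^T = A.

Lemma trmx_horner_sym (p : {poly R}) : (horner_mx A p)^T = horner_mx A p.
Proof.
elim/poly_ind: p => [|p c IH]; first by rewrite rmorph0 trmx0.
rewrite rmorphD rmorphM /= horner_mx_X horner_mx_C [LHS]raddfD /= tr_scalar_mx.
rewrite -[_ * _]/(_ *m _) trmx_mul IH symA; congr (_ + _).
exact: (comm_mx_horner p (comm_mx_refl A)).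
Qed.

Variables (lam : 'I_n.+1 -> R) (w : 'I_n.+1 -> 'I_n.+1 -> R).
Hypothesis spec : forall p x, horner_mx A p x x = \sum_k w x k * p.[lam k].

(** The vector [h] is phi(A) applied to the [i]-th basis vector. Interpolating at 0 too makes [p]
    divisible by X when phi(0) = 0, which [deflated_nash] exploits. *)
Lemma functional_calculus (phi : R -> R) (i : 'I_n.+1) : exists p : {poly R},
  let h j := horner_mx A p j i in
  [/\ p.[0] = phi 0, h i = \sum_k w i k * phi (lam k),
      \sum_j h j ^+ 2 = \sum_k w i k * phi (lam k) ^+ 2 &
      forall s, \sum_j h j * (h j + s * \sum_k A j k * h k) =
                \sum_k w i k * (phi (lam k) ^+ 2 * (1 + s * lam k))].
Proof.
have [p pE] := polynomial_interpolation (0 :: [seq lam k | k <- enum 'I_n.+1]) phi.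
have p_lam k : p.[lam k] = phi (lam k).
  by apply: pE; rewrite inE map_f ?orbT// mem_enum.
have hT j : horner_mx A p j i = horner_mx A p i j by rewrite -{1}trmx_horner_sym mxE.
exists p; split=> /=.
- by apply: pE; rewrite mem_head.
- by rewrite spec; apply: eq_bigr => k _; rewrite p_lam.
- transitivity (horner_mx A (p * p) i i).
    by rewrite rmorphM mxE; apply: eq_bigr => j _; rewrite hT expr2.
  by rewrite spec; apply: eq_bigr => k _; rewrite hornerM p_lam expr2.
- move=> s; transitivity (horner_mx A (p * ((1 + s *: 'X) * p)) i i).
    rewrite rmorphM mxE; apply: eq_bigr => j _; rewrite hT; congr (_ * _).
    rewrite mulrDl mul1r rmorphD /= mxE -scalerAl linearZ /= mxE -hT; congr (_ + s * _).
    by rewrite rmorphM /= horner_mx_X mxE.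
  rewrite spec; apply: eq_bigr => k _; rewrite !hornerM hornerD hornerC hornerZ hornerX p_lam; ring.
Qed.

End SpectralCalculus.

(** * Existence of the edge required by the Gagliardo-Nirenberg inequality *)

Section BadEdges.
Context {V : choiceType} {R : realFieldType}.
Variable e : rel V.
Implicit Type g : V -> R.

(** Otherwise the sign of [g] would be a proper 2-colouring. *)
Lemma nonbipartite_bad_edge g : ~ bipartite e ->
  exists y z, e y z /\ 0 <= 1 * (g y * g z).
Proof.
move=> nb; apply: contrapT => H; apply: nb; exists (fun y => 0 < g y) => y z yz.
have {}H : g y * g z < 0.
  by rewrite ltNge; apply/negP => h; apply: H; exists y, z; rewrite mul1r.
by apply/negP => /eqP yzE; move: H; case: ltP yzE => h1 /esym; case: ltP => h2 // _; nra.
Qed.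

Lemma zero_bad_edge g y z : e y z -> g y = 0 -> exists y z, e y z /\ 0 <= -1 * (g y * g z).
Proof. by move=> yz gy; exists y, z; rewrite gy mul0r mulr0. Qed.

(** Otherwise, by connectedness, [g] would have the sign of [g x] everywhere and could not sum to
    0. *)
Lemma zero_sum_bad_edge g (s : seq V) (x z : V) : connected_graph e -> e x z ->
  x \in s -> \sum_(y <- s) g y = 0 ->
  exists y z, e y z /\ 0 <= -1 * (g y * g z).
Proof.
move=> conn xz xs sum0; apply: contrapT => H.
have pos y z' : e y z' -> 0 < g y * g z'.
  move=> yz; rewrite ltNge; apply/negP => h; apply: H; exists y, z'.
  by rewrite mulN1r oppr_ge0.
have gx : g x != 0 by have := pos _ _ xz; apply: contraTneq => ->; rewrite mul0r ltxx.
have same y : 0 < g x * g y.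
  have [p pp <-] := conn x y; elim/last_ind: p pp => [|p y' IH] /=.
    by rewrite -expr2 exprn_even_gt0.
  rewrite rcons_path last_rcons => /andP[/IH h1 /pos h2].
  move: h1 h2; move: (g (last x p)) => u h1 h2.
  have : 0 < (g x * u) * (u * g y') by rewrite mulr_gt0.
  have -> : (g x * u) * (u * g y') = u ^+ 2 * (g x * g y') by ring.
  by rewrite pmulr_rgt0// exprn_even_gt0//=; apply: contraTneq h1 => ->; rewrite mulr0 ltxx.
have : 0 < \sum_(y <- s) g x * g y.
  rewrite (perm_big _ (perm_to_rem xs)) big_cons ltr_pwDl//.
  by apply: sumr_ge0 => y _; exact/ltW.
by rewrite -mulr_sumr sum0 mulr0 ltxx.
Qed.

End BadEdges.

Lemma sub_const_mxE (R : pzRingType) (m n : nat) (B : 'M[R]_(m, n)) (c : R) i j :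
  (B - c *: const_mx 1) i j = B i j - c.
Proof. by rewrite !mxE mulr1. Qed.

(** * Return probabilities as matrix powers *)

Section WalkMatrix.
Context {V : choiceType} {R : realType}.
Variables (e : rel V) (D : nat).
Hypothesis simple_e : simple_graph e.
Hypothesis finN : locally_finite e.
Hypothesis degD : forall y, degree e y = D.
Hypothesis D_gt0 : (0 < D)%N.
Hypothesis conn_e : connected_graph e.
Hypothesis nonbip_e : ~ bipartite e.

Local Notation nbrs x := (fset_set (neighbors e x)).

Lemma exists_neighbour y : exists z, e y z.
Proof.
have : nbrs y != fset0 by rewrite -cardfs_gt0; have := degD y; rewrite /degree => ->.
by move=> /fset0Pn[z]; rewrite mem_nbrs//; exists z.
Qed.

Variables (n : nat) (v : 'I_n.+1 -> V).
Hypothesis v_inj : injective v.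

Local Notation M := (transition_mx e v : 'M[R]_n.+1).

(** Powers of the matrix describe the walk killed on leaving the range of [v], which cannot happen
    within [t] steps. *)
Lemma walk_prob_mx (t : nat) (i j : 'I_n.+1) :
  (forall p, path e (v i) p -> (size p <= t)%N -> exists k, last (v i) p = v k) ->
  walk_prob R e t (v i) (v j) = (M ^+ t) i j.
Proof.
elim: t i => [|t IH] i cover /=.
  by rewrite expr0 mxE (inj_eq v_inj).
pose F z := walk_prob R e t z (v j).
rewrite -mulr_sumr exprS mxE.
have -> : \sum_(z <- nbrs (v i)) walk_prob R e t z (v j) =
    \sum_(z <- nbrs (v i)) extend_vec v (fun k => F (v k)) z.
  rewrite !big_seq; apply: eq_bigr => z; rewrite mem_nbrs// => iz.
  have [||k /= ->] := cover [:: z]; rewrite /= ?iz//.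
  by rewrite (extend_vecE v_inj).
rewrite degD (sum_neighbours_extend finN degD)// mulKf ?pnatr_eq0 -?lt0n//.
apply: eq_bigr => k _; rewrite (transition_mxE finN degD).
case: (boolP (e (v i) (v k))) => ik; last by rewrite mulr0 !mul0r.
congr (_ * _); apply: IH => p pp sp.
by apply: (cover (v k :: p)) => //=; rewrite ik.
Qed.

Section Covering.
Hypothesis v_surj : forall y, exists k, y = v k.

Lemma transition_mx_row_sum i : \sum_j M i j = 1.
Proof.
have h : D%:R * \sum_j M i j * 1 = D%:R :> R.
  rewrite -(sum_neighbours_extend finN degD D_gt0 v (fun=> 1)).
  rewrite (eq_bigr (fun=> 1)) => [|z _].
    by rewrite big_const_seq count_predT iter_addr_0; have := degD (v i); rewrite /degree => ->.
  by have [k ->] := v_surj z; rewrite (extend_vecE v_inj).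
have D0 : (D%:R : R) != 0 by rewrite pnatr_eq0 -lt0n.
apply: (mulfI D0); rewrite mulr1 -[RHS]h; congr (_ * _).
by apply: eq_bigr => j _; rewrite mulr1.
Qed.

Local Notation J := (const_mx 1 : 'M[R]_n.+1).

Lemma transition_mxJ : M * J = J.
Proof.
apply/matrixP => i j; rewrite !mxE -[RHS](transition_mx_row_sum i).
by apply: eq_bigr => k _; rewrite [J k j]mxE mulr1.
Qed.

Lemma Jtransition_mx : J * M = J.
Proof.
apply: trmx_inj; rewrite -[J * M]/(J *m M) trmx_mul (transition_mx_sym simple_e finN degD).
by rewrite trmx_const; exact: transition_mxJ.
Qed.

Lemma JJ : J * J = n.+1%:R *: J.
Proof.
apply/matrixP => i j; rewrite !mxE mulr1.
by rewrite (eq_bigr (fun=> 1)) ?sumr_const ?card_ord// => k _; rewrite !mxE mulr1.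
Qed.

(** [c *: J] is the projection on constants, fixed by [M] on both sides. The exponent must be
    positive: the zeroth power is 1. *)
Lemma deflated_power (t : nat) : let c := n.+1%:R^-1 in
  (M - c *: J) ^+ t.+1 = M ^+ t.+1 - c *: J.
Proof.
move=> c; have MtJ k : M ^+ k * J = J.
  by elim: k => [|k IH]; rewrite ?expr0 ?mul1r// exprSr -mulrA transition_mxJ.
elim: t => [|t IH]; first by rewrite !expr1.
rewrite exprSr IH mulrBr !mulrBl -exprSr -!scalerAr -!scalerAl MtJ Jtransition_mx JJ.
have cn : c * n.+1%:R = 1 by rewrite /c mulVf// pnatr_eq0.
by rewrite !scalerA -mulrA cn mulr1 subrr subr0.
Qed.

End Covering.

(** On vectors of sum zero, [A] and [M] act alike, so the inequality for [M] applies. The edge it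
    requires for s = -1 comes from the vertex that [v] misses or from the vanishing sum. *)
Lemma deflated_nash (c s : R) (i : 'I_n.+1) (p : {poly R})
    (A := M - c *: const_mx 1) (h := fun j => horner_mx A p j i) :
  (c = 0 /\ exists y, forall k, y <> v k) \/
  (c = n.+1%:R^-1 /\ forall y, exists k, y = v k) ->
  s = 1 \/ s = -1 -> p.[0] = 0 ->
  h i ^+ 4 <= 64 * (\sum_j h j ^+ 2) * (\sum_j h j * (h j + s * \sum_k A j k * h k)).
Proof.
move=> cE sE p0.
have hsum : c = 0 \/ (c <> 0 /\ \sum_j h j = 0).
  case: cE => [[->]|[cE surj]]; [by left | right; split].
    by rewrite cE; apply/eqP; rewrite invr_eq0 pnatr_eq0.
  have JA : (const_mx 1 : 'M[R]_n.+1) * A = 0.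
    by rewrite /A mulrBr -scalerAr Jtransition_mx// JJ scalerA cE mulVf ?pnatr_eq0// scale1r subrr.
  (* As p = q X and J A = 0, every column of p(A) sums to 0. *)
  have /factor_theorem[q pE] : root p 0 by apply/rootP.
  have : ((const_mx 1 : 'M[R]_n.+1) * horner_mx A p) i i = 0.
    by rewrite pE subr0 mulrC rmorphM /= horner_mx_X mulrA JA mul0r mxE.
  by rewrite mxE => h0; rewrite -[RHS]h0; apply: eq_bigr => j _; rewrite mxE mul1r.
have -> : \sum_j h j * (h j + s * \sum_k A j k * h k) =
          \sum_j h j * (h j + s * \sum_k M j k * h k).
  apply: eq_bigr => j _; congr (_ * (_ + _ * _)).
  have -> : \sum_k A j k * h k = \sum_k M j k * h k - c * \sum_k h k.
    rewrite mulr_sumr -sumrB; apply: eq_bigr => k _.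
    by rewrite sub_const_mxE mulrBl.
  by case: hsum => [->|[_ ->]]; rewrite ?mul0r ?mulr0 subr0.
apply: (matrix_gagliardo_nirenberg simple_e finN degD) => //.
  by case: sE => ->; rewrite ?expr1n ?sqrrN ?expr1n.
case: sE => ->; first exact: nonbipartite_bad_edge.
case: cE => [[_ [y yv]]|[cE surj]].
  have [z yz] := exists_neighbour y.
  apply: (zero_bad_edge yz); apply: extend_vec_out => k; apply/eqP; exact: yv.
have [z iz] := exists_neighbour (v i).
apply: (@zero_sum_bad_edge _ _ e _ [seq v k | k <- enum 'I_n.+1] (v i) z) => //.
  by rewrite map_f// mem_enum.
case: hsum => [c0|[_ h0]].
  by move: cE; rewrite c0 => /esym/eqP; rewrite invr_eq0 pnatr_eq0.
by rewrite -[RHS]h0 big_map big_enum; apply: eq_bigr => k _; rewrite (extend_vecE v_inj).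
Qed.

(* If [v] enumerates the whole graph, subtracting [c] times the all-ones matrix
   removes the constant functions from the spectrum; otherwise functions supported
   on the range of [v] vanish somewhere, and nothing has to be removed. *)
Lemma return_prob_split (c : R) (i : 'I_n.+1) (t : nat) : (0 < t)%N ->
  (c = 0 /\ exists y, forall k, y <> v k) \/
  (c = n.+1%:R^-1 /\ forall y, exists k, y = v k) ->
  (forall p, path e (v i) p -> (size p <= t)%N -> exists k, last (v i) p = v k) ->
  exists a b : R, [/\ 0 <= a, 0 <= b, 2 * t%:R * a ^+ 2 <= 64, 2 * t%:R * b ^+ 2 <= 64 &
    walk_prob R e t (v i) (v i) - c = a + (-1) ^+ t * b].
Proof.
move=> t0 cE cover.
pose A := M - c *: const_mx 1.
have symA : A^T = A.
  by rewrite /A raddfB /= linearZ /= trmx_const (transition_mx_sym simple_e finN degD).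
have [lam [w' [w0' _ spec _]]] := symmetric_spectral_measure symA.
pose w := w' i.
have w0 k : 0 <= w k by exact: w0'.
have nash (s : R) : s = 1 \/ s = -1 -> forall phi : R -> R, phi 0 = 0 ->
    (\sum_k w k * phi (lam k)) ^+ 4 <= 64 * (\sum_k w k * phi (lam k) ^+ 2) *
      (\sum_k w k * (phi (lam k) ^+ 2 * (1 + s * lam k))).
  move=> sE phi phi0; have [p [p0 h1 h2 h3]] := functional_calculus symA spec phi i.
  by rewrite /w -h1 -h2 -h3; apply: deflated_nash => //; rewrite p0.
have c64 : (0 : R) < 64 by [].
have nashp (phi : R -> R) : phi 0 = 0 ->
    (\sum_k w k * phi (lam k)) ^+ 4 <= 64 * (\sum_k w k * phi (lam k) ^+ 2) *
      (\sum_k w k * (phi (lam k) ^+ 2 * (1 - lam k))).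
  move=> /(nash (-1) (or_intror erefl)).
  by under [X in _ <= _ * X -> _]eq_bigr do rewrite mulN1r.
(* The case s = 1, read on the spectral measure reflected by l -> -l. *)
have nashn (phi : R -> R) : phi 0 = 0 ->
    (\sum_k w k * phi (- lam k)) ^+ 4 <= 64 * (\sum_k w k * phi (- lam k) ^+ 2) *
      (\sum_k w k * (phi (- lam k) ^+ 2 * (1 - - lam k))).
  move=> phi0; have := nash 1 (or_introl erefl) (fun l => phi (- l)).
  rewrite oppr0 => /(_ phi0).
  by under [X in _ <= _ * X -> _]eq_bigr do rewrite mul1r -[X in 1 + X]opprK.
(* The moments of the positive part and of the reflected negative part; the sign (-1)^t undoes the
   reflection. *)
exists (\sum_(k | 0 < lam k) w k * lam k ^+ t).
exists (\sum_(k | 0 < - lam k) w k * (- lam k) ^+ t); split.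
- exact: power_sum_ge0.
- exact: (@power_sum_ge0 _ _ w (fun k => - lam k)).
- exact: power_sum_decay.
- exact: (@power_sum_decay _ _ w (fun k => - lam k)).
- have -> : walk_prob R e t (v i) (v i) - c = (A ^+ t) i i.
    rewrite walk_prob_mx//; case: cE => [[c0 _]|[cE surj]].
      by rewrite /A c0 scale0r !subr0.
    case: t t0 {cover} => // t _.
    by rewrite /A cE (deflated_power surj) sub_const_mxE.
  have -> : A ^+ t = horner_mx A 'X^t by rewrite rmorphXn /= horner_mx_X.
  rewrite spec mulr_sumr [X in X + _]big_mkcond [X in _ + X]big_mkcond -big_split /=.
  apply: eq_bigr => k _; rewrite hornerXn oppr_gt0 -/w.
  (* The eigenvalue 0 belongs to neither part and contributes nothing, as t > 0. *)
  case: ltgtP => [lk|lk|<-]; rewrite ?addr0 ?add0r//.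
    by rewrite mulrCA -exprMn mulN1r opprK.
  by rewrite expr0n; case: t t0 {cover} => //= t' _; rewrite !mulr0 ?addr0.
Qed.

End WalkMatrix.

(** * Enumerations, balls and the handshake identity *)

Section Vertices.
Context {V : choiceType}.
Variables (e : rel V) (D : nat).
Hypothesis simple_e : simple_graph e.
Hypothesis finN : locally_finite e.
Hypothesis degD : forall y, degree e y = D.

Local Notation nbrs x := (fset_set (neighbors e x)).

Lemma enumerate_seq (B : seq V) (x : V) : uniq B -> x \in B ->
  exists (n : nat) (v : 'I_n.+1 -> V),
  [/\ injective v, size B = n.+1 & forall y, y \in B -> exists k, y = v k].
Proof.
move=> uB xB; have [n nB] : exists n, size B = n.+1.
  by case: (B) xB => // a s _; exists (size s).
exists n, (fun i : 'I_n.+1 => nth x B i); split=> //.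
- move=> i j /eqP; rewrite nth_uniq ?nB// => /eqP; exact: val_inj.
- move=> y yB; have yi : (index y B < n.+1)%N by rewrite -nB index_mem.
  by exists (Ordinal yi); rewrite /= nth_index.
Qed.

Lemma finite_ball (x : V) (t : nat) : exists B : seq V,
  [/\ uniq B, x \in B & forall p, path e x p -> (size p <= t)%N -> last x p \in B].
Proof.
elim: t => [|t [B [uB xB IH]]].
  by exists [:: x]; split; rewrite ?mem_head// => -[|//] *; rewrite mem_head.
exists (undup (B ++ flatten [seq enum_fset (nbrs y) | y <- B])); split.
- exact: undup_uniq.
- by rewrite mem_undup mem_cat xB.
- elim/last_ind => [|p z _]; first by rewrite mem_undup mem_cat xB.
  rewrite rcons_path last_rcons size_rcons ltnS => /andP[pp yz] /(IH p pp) yB.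
  rewrite mem_undup mem_cat; apply/orP; right; apply/flattenP.
  exists (enum_fset (nbrs (last x p))); first by apply/mapP; exists (last x p).
  by rewrite mem_nbrs.
Qed.

(** Incident pairs of a vertex and an edge are counted in two ways; this identifies the stationary
    probability as 1 / n. *)
Lemma handshake (B : seq V) : uniq B -> (forall y, y \in B) ->
  (size B * D = 2 * #|` fset_set (edges e)|)%N.
Proof.
move=> uB allB.
have neq y z : e y z -> y != z by apply: contraTneq => ->; rewrite simple_e.2.
pose s := flatten [seq [seq [fset y; z]%fset | z <- nbrs y] | y <- B].
pose Es := seq_fset tt s.
have EsE : fset_set (edges e) = Es.
  rewrite -[RHS]set_fsetK; congr fset_set; apply/seteqP; split=> A /=.
    move=> [y [z [yz ->]]]; rewrite seq_fsetE; apply/flattenP.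
    exists [seq [fset y; z]%fset | z <- nbrs y]; first by apply/mapP; exists y.
    by apply/mapP; exists z => //; rewrite mem_nbrs.
  rewrite seq_fsetE => /flattenP[_ /mapP[y _ ->]] /mapP[z].
  by rewrite mem_nbrs// => yz ->; exists y, z.
have mem_edge A : A \in Es -> exists y z, e y z /\ A = [fset y; z]%fset.
  rewrite -EsE => AE; have : A \in [set` fset_set (edges e)] by rewrite inE.
  rewrite EsE inE /= seq_fsetE => /flattenP[_ /mapP[y _ ->]] /mapP[z].
  by rewrite mem_nbrs// => yz ->; exists y, z.
have edge_mem y z : e y z -> [fset y; z]%fset \in Es.
  move=> yz; rewrite seq_fsetE; apply/flattenP.
  exists [seq [fset y; z]%fset | z <- nbrs y]; first by apply/mapP; exists y.
  by apply/mapP; exists z => //; rewrite mem_nbrs.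
have degE y : (\sum_(A <- Es) (y \in A) = D)%N.
  have -> : (\sum_(A <- Es) (y \in A) = size [seq A <- Es | y \in A])%N.
    rewrite size_filter -sum1_count [RHS]big_mkcond; apply: eq_bigr => A _.
    by case: (y \in A).
  rewrite -(degD y) /degree -[RHS](size_map (fun z => [fset y; z]%fset)).
  apply: (@perm_size {fset V}); apply: uniq_perm.
  - by rewrite filter_uniq// fset_uniq.
  - rewrite map_inj_in_uniq ?fset_uniq// => z z'; rewrite !mem_nbrs// => yz yz' /fsetP/(_ z).
    by rewrite !in_fset2 eqxx orbT => /esym/orP[/eqP zy|/eqP//]; have := neq _ _ yz; rewrite zy eqxx.
  - move=> A; rewrite mem_filter; apply/andP/mapP.
      move=> [yA /mem_edge[u [z [uz AE]]]]; move: yA; rewrite AE in_fset2.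
      move=> /orP[/eqP ->|/eqP ->]; first by exists z => //; rewrite mem_nbrs.
      by exists u; [rewrite mem_nbrs// simple_e.1 | rewrite fsetUC].
    move=> [z]; rewrite mem_nbrs// => yz ->; split; last exact: edge_mem.
    by rewrite in_fset2 eqxx.
have twoE A : A \in Es -> (\sum_(y <- B) (y \in A) = 2)%N.
  move=> /mem_edge[u [z [uz ->]]].
  have -> : (\sum_(y <- B) (y \in [fset u; z]%fset) = size [seq y <- B | y \in [fset u; z]%fset])%N.
    rewrite size_filter -sum1_count [RHS]big_mkcond; apply: eq_bigr => y _.
    by case: (y \in _).
  rewrite -[RHS]/(size [:: u; z]); apply: perm_size; apply: uniq_perm.
  - exact: filter_uniq.
  - by rewrite /= inE neq.
  - by move=> y; rewrite mem_filter allB andbT in_fset2 !inE.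
rewrite EsE; transitivity (\sum_(y <- B) \sum_(A <- Es) (y \in A))%N.
  by rewrite (eq_bigr (fun=> D)) => [|y _]; rewrite ?degE// big_const_seq count_predT iter_addn_0 mulnC.
rewrite exchange_big /= big_seq (eq_bigr (fun=> 2%N)) => [|A AE]; last exact: twoE.
by rewrite -big_seq big_const_seq count_predT iter_addn_0.
Qed.

End Vertices.

(** * Bounds on return probabilities and on eigenvalues *)

Section ReturnProbability.
Context {V : choiceType} {R : realType}.
Variables (e : rel V) (D : nat).
Hypothesis simple_e : simple_graph e.
Hypothesis finN : locally_finite e.
Hypothesis degD : forall y, degree e y = D.
Hypothesis D_gt0 : (0 < D)%N.
Hypothesis conn_e : connected_graph e.
Hypothesis nonbip_e : ~ bipartite e.

Lemma return_prob_decomposition (x : V) (t : nat) : (0 < t)%N ->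
  exists a b : R, [/\ 0 <= a <= 9 / Num.sqrt t%:R, 0 <= b <= 9 / Num.sqrt t%:R &
    walk_prob R e t x x - stationary R e x = a + (-1) ^+ t * b].
Proof.
move=> t0.
have st : (0 : R) < Num.sqrt t%:R by rewrite sqrtr_gt0 ltr0n.
(* The moment bound gives t a^2 <= 32, which is below 9^2. *)
have bound (a : R) : 0 <= a -> 2 * t%:R * a ^+ 2 <= 64 -> 0 <= a <= 9 / Num.sqrt t%:R.
  move=> a0 h; rewrite a0 /= ler_pdivlMr// -(@ler_pXn2r _ 2) ?nnegrE ?mulr_ge0 ?(ltW st)//.
  by rewrite exprMn sqr_sqrtr ?ler0n//; lra.
suff [a [b [a0 b0 ha hb ->]]] : exists a b : R,
    [/\ 0 <= a, 0 <= b, 2 * t%:R * a ^+ 2 <= 64, 2 * t%:R * b ^+ 2 <= 64 &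
    walk_prob R e t x x - stationary R e x = a + (-1) ^+ t * b].
  by exists a, b; rewrite !bound.
rewrite /stationary; case: asboolP => [finV|infV].
  (* In a finite graph all vertices are listed, and the constants are removed with c = 1 / n. *)
  pose B := enum_fset (fset_set [set: V]).
  have allB y : y \in B by rewrite in_fset_set// inE.
  have uB : uniq B by exact: fset_uniq.
  have [n [v [vinj nB surj]]] := enumerate_seq uB (allB x).
  have [i ->] := surj _ (allB x).
  have -> : (degree e (v i))%:R / (2 * #|` fset_set (edges e)|%:R) = n.+1%:R^-1 :> R.
    rewrite degD -natrM -(handshake simple_e finN degD uB allB) nB natrM invfM mulrCA.
    by rewrite mulfV ?mulr1// pnatr_eq0 -lt0n.
  apply: (return_prob_split simple_e finN degD) => //.
    by right; split=> // y; exact: surj.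
  by move=> p _ _; exact: surj.
(* In an infinite graph a finite set that the walk cannot leave in [t] steps suffices; it misses
   some vertex, so c = 0. *)
have [B [uB xB cover]] := finite_ball finN x t.
have [n [v [vinj nB surj]]] := enumerate_seq uB xB.
have [i xi] := surj _ xB; rewrite xi.
apply: (return_prob_split simple_e finN degD) => //; last first.
  by move=> p pp sp; apply: surj; rewrite -xi; apply: cover; rewrite ?xi.
left; split=> //; apply: contrapT => H; apply: infV.
apply: (sub_finite_set _ (finite_seq [seq v k | k <- enum 'I_n.+1])) => y _ /=.
apply/mapP; apply: contrapT => ny; apply: H; exists y => k yk; apply: ny.
by exists k => //; rewrite mem_enum.
Qed.

(** The spectral masses of the half-line up to lambda_k, summed over all vertices, count the
    eigenvalues there and so total at least k. Each mass is at most 8 sqrt(1 + lambda_k), hence k <=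
    8 n sqrt(1 + lambda_k). *)
Lemma eigenvalue_lower_bound (n : nat) (v : 'I_n -> V) (lam : seq R) (k : nat) :
  bijective v -> sorted_eigenvalues (transition_mx e v) lam -> (1 <= k <= n)%N ->
  -1 + k%:R ^+ 2 / (100 * n%:R ^+ 2) <= lam`_k.-1.
Proof.
case: n v => [|n] v bij_v; first by case: k.
move=> [sort_lam char_lam] /andP[k1 kn].
have v_inj : injective v := bij_inj bij_v.
have symM := transition_mx_sym (R := R) simple_e finN degD v.
have [lam' [w [w0 w1 spec charE]]] := symmetric_spectral_measure symM.
pose ls := [seq lam' j | j <- enum 'I_n.+1].
have perm_ls : perm_eq lam ls.
  by apply: prod_XsubC_eq; rewrite -char_lam charE big_map big_enum.
pose th := lam`_k.-1; pose d := 1 + th.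
pose phi (l : R) : R := (l <= th)%R%:R.
have phi2 l : phi l ^+ 2 = phi l by rewrite /phi; case: (_ <= _); rewrite ?expr1n ?expr0n.
pose mu x := \sum_j w x j * phi (lam' j).
have mu0 x : 0 <= mu x by apply: sumr_ge0 => j _; rewrite mulr_ge0// /phi ler0n.
(* For the spectral projection of [x], both its value at [x] and its squared norm equal [mu x], and
   its energy is at most [mu x * d]. *)
have mu_sqr x : 0 < mu x -> mu x ^+ 2 <= 64 * d.
  move=> mx; have [p [_ h1 h2 h3]] := functional_calculus symM spec phi x.
  have := matrix_gagliardo_nirenberg simple_e finN degD D_gt0 v_inj (s := 1)
    (h := fun j => horner_mx (transition_mx e v : 'M[R]_n.+1) p j x) x conn_e (expr1n _ _)
    (nonbipartite_bad_edge _ nonbip_e).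
  rewrite h1 h2 h3 -/(mu x).
  have -> : \sum_j w x j * phi (lam' j) ^+ 2 = mu x by apply: eq_bigr => j _; rewrite phi2.
  have le_d : \sum_j w x j * (phi (lam' j) ^+ 2 * (1 + 1 * lam' j)) <= mu x * d.
    rewrite /mu mulr_suml; apply: ler_sum => j _; rewrite -mulrA ler_wpM2l// phi2 mul1r.
    by rewrite /phi; case: (leP (lam' j) th) => h /=; rewrite ?mul0r// !mul1r lerD2l.
  have mm : 0 < mu x ^+ 2 by rewrite exprn_gt0.
  have h4 : 64 * mu x * \sum_j w x j * (phi (lam' j) ^+ 2 * (1 + 1 * lam' j)) <= 64 * mu x * (mu x * d).
    by rewrite ler_wpM2l// mulr_ge0.
  move=> /le_trans/(_ h4).
  have -> : 64 * mu x * (mu x * d) = mu x ^+ 2 * (64 * d) by ring.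
  by rewrite -[mu x ^+ 4]/(mu x ^+ (2 + 2)) exprD (ler_pM2l mm).
have k_le : k%:R <= \sum_x mu x.
  rewrite /mu exchange_big /=.
  have -> : \sum_j \sum_i w i j * phi (lam' j) = \sum_(l <- lam) phi l.
    rewrite (perm_big _ perm_ls) big_map big_enum; apply: eq_bigr => j _.
    by rewrite -mulr_suml w1 mul1r.
  have size_lam : size lam = n.+1 by rewrite (perm_size perm_ls) size_map size_enum_ord.
  have -> : \sum_(l <- lam) phi l = (count (fun l => l <= th) lam)%:R.
    by rewrite -sum1_count natr_sum [RHS]big_mkcond; apply: eq_bigr => l _; rewrite /phi; case: ifP.
  rewrite ler_nat -{1}(cat_take_drop k lam) count_cat.
  apply: leq_trans (leq_addr _ _).
  have sk : size (take k lam) = k by rewrite size_takel// size_lam.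
  rewrite -[X in (X <= _)%N]sk; have /all_filterP : all (fun l => l <= th) (take k lam); last first.
    by rewrite -size_filter => ->.
  apply/(all_nthP 0) => i; rewrite sk => ik; rewrite nth_take//.
  apply: (le_sorted_leq_nth 0 sort_lam); rewrite ?inE ?size_lam; lia.
(* As the masses sum to at least k >= 1, one of them is positive, and [mu_sqr] then excludes a
   negative [d]. *)
have d0 : 0 <= d.
  have [x mx] : exists x, 0 < mu x.
    apply: contrapT => H; have : \sum_x mu x <= 0.
      by apply: sumr_le0 => x _; rewrite leNgt; apply/negP => h; apply: H; exists x.
    by rewrite leNgt => /negP; apply; apply: lt_le_trans k_le; rewrite ltr0n.
  by have := mu_sqr x mx; have := sqr_ge0 (mu x); lra.
have mu_le x : mu x <= 8 * Num.sqrt d.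
  have [mx|mx] := ltP 0 (mu x); last first.
    by apply: le_trans mx _; rewrite mulr_ge0// sqrtr_ge0.
  rewrite -(@ler_pXn2r _ 2) ?nnegrE ?mulr_ge0 ?sqrtr_ge0// exprMn sqr_sqrtr//.
  by have := mu_sqr x mx; lra.
have : k%:R <= n.+1%:R * (8 * Num.sqrt d).
  apply: le_trans k_le _; apply: le_trans (ler_sum _ (fun x _ => mu_le x)) _.
  by rewrite sumr_const card_ord (mulr_natl (8 * _)).
rewrite -(@ler_pXn2r _ 2) ?nnegrE ?mulr_ge0 ?sqrtr_ge0// !exprMn sqr_sqrtr// => h.
have n0 : (0 : R) < n.+1%:R ^+ 2 by rewrite exprn_gt0// ltr0n.
suff : k%:R ^+ 2 / (100 * n.+1%:R ^+ 2) <= d by rewrite /d -lerBlDl addrC.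
rewrite ler_pdivrMr ?mulr_gt0//.
have : 0 <= n.+1%:R ^+ 2 * d by rewrite mulr_ge0// ltW.
lra.
Qed.

End ReturnProbability.

(** * The vertex spectral measure *)

Section ComplexParts.
Context {R : realType}.
Implicit Types z w : R[i].

Lemma ReMJ z w : complex.Re (z * w^*) =
  complex.Re z * complex.Re w + complex.Im z * complex.Im w.
Proof. by case: z w => [a b] [c d] /=; ring. Qed.

Lemma ImMJ z w : complex.Im (z * w^*) =
  complex.Im z * complex.Re w - complex.Re z * complex.Im w.
Proof. by case: z w => [a b] [c d] /=; ring. Qed.

Lemma Re_natM (n : nat) z : complex.Re (n%:R * z) = n%:R * complex.Re z.
Proof.
rewrite -(rmorph_nat (real_complex R)); case: z => a b /=; ring.
Qed.

Lemma Im_natM (n : nat) z : complex.Im (n%:R * z) = n%:R * complex.Im z.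
Proof.
rewrite -(rmorph_nat (real_complex R)); case: z => a b /=; ring.
Qed.

Lemma ReD z w : complex.Re (z + w) = complex.Re z + complex.Re w.
Proof. by case: z w => [a b] [c d]. Qed.

Lemma ImD z w : complex.Im (z + w) = complex.Im z + complex.Im w.
Proof. by case: z w => [a b] [c d]. Qed.

Lemma Re_sum (T : Type) (s : seq T) (F : T -> R[i]) :
  complex.Re (\sum_(z <- s) F z) = \sum_(z <- s) complex.Re (F z).
Proof. by elim: s => [|a s IH]; rewrite ?big_nil ?big_cons ?ReD ?IH. Qed.

Lemma Im_sum (T : Type) (s : seq T) (F : T -> R[i]) :
  complex.Im (\sum_(z <- s) F z) = \sum_(z <- s) complex.Im (F z).
Proof. by elim: s => [|a s IH]; rewrite ?big_nil ?big_cons ?ImD ?IH. Qed.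

End ComplexParts.

(** * Unconditional sums through their finite partial sums *)

Section NonnegativeSums.
Context {R : realType} {V : choiceType}.
Implicit Types h a b u : V -> R.

Local Notation tsum h := (fine (\esum_(x in [set: V]) (h x)%:E)%E).

Definition bounded_sums h (M : R) := forall S, uniq S -> \sum_(y <- S) h y <= M.

Lemma esum_le_bound h (M : R) : bounded_sums h M ->
  (\esum_(x in [set: V]) (h x)%:E <= M%:E)%E.
Proof.
move=> hM; apply: ge_ereal_sup => _ [X [finX _] <-].
by rewrite fsbig_finite//= sumEFin lee_fin; apply: hM.
Qed.

Lemma esum_fin_num h (M : R) : (forall y, 0 <= h y) -> bounded_sums h M ->
  (\esum_(x in [set: V]) (h x)%:E)%E \is a fin_num.
Proof.
move=> h0 hM; rewrite ge0_fin_numE; last by apply: esum_ge0 => y _; rewrite lee_fin.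
exact: le_lt_trans (esum_le_bound hM) (ltry _).
Qed.

Lemma tsum_le h (M : R) : (forall y, 0 <= h y) -> bounded_sums h M -> tsum h <= M.
Proof.
by move=> h0 hM; rewrite -lee_fin fineK ?(esum_fin_num h0 hM)//; exact: esum_le_bound.
Qed.

Lemma le_tsum h : (forall y, 0 <= h y) ->
  (\esum_(x in [set: V]) (h x)%:E < +oo)%E -> bounded_sums h (tsum h).
Proof.
move=> h0 hfin S uS.
rewrite -lee_fin fineK ?ge0_fin_numE//; last by apply: esum_ge0 => y _; rewrite lee_fin.
apply: esum_ge; exists [set` S]; first by split=> //; exact: finite_seq.
by rewrite -fsbig_seq//= sumEFin.
Qed.

(** [real_sum] is defined through positive and negative parts; this evaluates it from any splitting
    into two nonnegative summable families. *)
Lemma real_sum_diff a b (Ma Mb : R) : (forall y, 0 <= a y) -> (forall y, 0 <= b y) ->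
  bounded_sums a Ma -> bounded_sums b Mb ->
  real_sum (fun y => a y - b y) = tsum a - tsum b.
Proof.
move=> a0 b0 hMa hMb.
have summ h M : (forall y, 0 <= h y) -> bounded_sums h M ->
    summable [set: V] (EFin \o h).
  move=> h0 hM; rewrite /summable; apply: le_lt_trans (ltry M).
  apply: le_trans (esum_le_bound hM); apply: le_esum => y _ /=.
  by rewrite ger0_norm.
have fina := esum_fin_num a0 hMa; have finb := esum_fin_num b0 hMb.
have := esumB (summ _ _ a0 hMa) (summ _ _ b0 hMb).
move=> /(_ (fun y _ => a0 y)) /(_ (fun y _ => b0 y)).
rewrite /real_sum.
have -> : ((EFin \o a) \- (EFin \o b))%E = EFin \o (fun y => a y - b y) by [].
rewrite funerpos funerneg /= => h.
have posle : bounded_sums (fun y => a y - b y)^\+ Ma.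
  move=> S uS; apply: le_trans (hMa S uS); apply: ler_sum => y _.
  by rewrite /funrpos ge_max a0 andbT lerBlDr lerDl.
have negle : bounded_sums (fun y => a y - b y)^\- Mb.
  move=> S uS; apply: le_trans (hMb S uS); apply: ler_sum => y _.
  by rewrite /funrneg ge_max b0 andbT opprB lerBlDr lerDl.
have finpos := esum_fin_num (funrpos_ge0 _) posle.
have finneg := esum_fin_num (funrneg_ge0 _) negle.
by have := congr1 fine h; rewrite !fineB.
Qed.

Lemma tsum_eq0 h : (forall y, h y = 0) -> tsum h = 0.
Proof. by move=> h0; rewrite esum1//= => y _; rewrite h0. Qed.

Lemma real_sum0 u : (forall y, u y = 0) -> real_sum u = 0.
Proof.
move=> u0; rewrite /real_sum !tsum_eq0 ?subr0// => y.
  by rewrite /funrneg u0 oppr0 maxxx.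
by rewrite /funrpos u0 maxxx.
Qed.

Lemma esum_pred1 h x : (forall y, 0 <= h y) -> (forall y, y != x -> h y = 0) ->
  (\esum_(y in [set: V]) (h y)%:E = (h x)%:E)%E.
Proof.
move=> h0 hx; rewrite -(@esum_set1 _ _ x (fun y => (h y)%:E)) ?lee_fin//.
rewrite [RHS]esum_mkcond; apply: eq_esum => y _.
by case: ifPn => //; rewrite notin_setE => /= yx; rewrite hx//; apply/eqP.
Qed.

Lemma real_sum_pred1 u x : (forall y, y != x -> u y = 0) -> real_sum u = u x.
Proof.
move=> ux; rewrite /real_sum !(esum_pred1 (x := x)) /=.
- by rewrite -[in RHS](funrposBneg u).
- by move=> y; rewrite /funrneg le_max lexx orbT.
- by move=> y yx; rewrite /funrneg ux// oppr0 maxxx.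
- by move=> y; rewrite /funrpos le_max lexx orbT.
- by move=> y yx; rewrite /funrpos ux// maxxx.
Qed.

End NonnegativeSums.

(** Discarding the negative part only increases the integral; the positive part is at most [delta]
    on the interval that carries the measure. *)
Lemma integral_id_le (R : realType) (mu : {measure set (measurableTypeR R) -> \bar R})
    (delta : R) : 0 <= delta -> mu (~` `[0, delta]%classic) = 0%E ->
  (\int[mu]_l l%:E <= delta%:E * mu `[0%R, delta]%classic)%E.
Proof.
move=> d0 mu0; pose B : set (measurableTypeR R) := `[0, delta]%classic.
have mB : measurable B by exact: measurable_itv.
have mid := @EFin_measurable R [set: R].
rewrite integralE.
apply: (@le_trans _ _ (\int[mu]_l ((@EFin R)^\+ l)))%E.
  by rewrite geeDl// oppe_le0 integral_ge0.
rewrite (@ge0_negligible_integral _ _ _ mu setT (~` B))//; last 2 first.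
- exact: measurableC.
- exact: measurable_funepos.
rewrite setTD setCK -(integral_cst mu mB delta%:E); apply: ge0_le_integral => //.
- apply: measurable_funTS; exact: measurable_funepos.
- move=> l; rewrite /B /= in_itv /= => /andP[l0 ld].
  by rewrite funeposE ge_max !lee_fin ld.
Qed.

(** * The energy form of Q and its spectral projections *)

Section VertexSpectralMeasure.
Context {V : choiceType} {R : realType}.
Variables (e : rel V) (D : nat).
Hypothesis simple_e : simple_graph e.
Hypothesis finN : locally_finite e.
Hypothesis degD : forall y, degree e y = D.
Hypothesis D_gt0 : (0 < D)%N.

Local Notation nbrs x := (fset_set (neighbors e x)).
Local Notation sqn z := (complex.Re z ^+ 2 + complex.Im z ^+ 2).

Lemma l2E (f : V -> R[i]) :
  (fun y => ((degree e y)%:R * complex.Re (f y * (f y)^*))%:E) =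
  (fun y => (D%:R * sqn (f y))%:E).
Proof. by apply/funext => y; rewrite degD ReMJ !expr2. Qed.

Lemma sqn_ge0 (z : R[i]) : 0 <= sqn z.
Proof. by rewrite addr_ge0// sqr_ge0. Qed.

Lemma l2_lty (f : V -> R[i]) : l2 e f ->
  (\esum_(y in [set: V]) (D%:R * sqn (f y))%:E < +oo)%E.
Proof. by rewrite /l2 l2E. Qed.

Lemma inner_self_Re (f : V -> R[i]) : l2 e f ->
  complex.Re (inner e f f) = fine (\esum_(y in [set: V]) (D%:R * sqn (f y))%:E)%E.
Proof.
move=> /l2_lty lef; have f0 y : 0 <= D%:R * sqn (f y) by rewrite mulr_ge0// sqn_ge0.
rewrite /inner /= (_ : (fun y => _) = (fun y => D%:R * sqn (f y) - 0)).
  rewrite (real_sum_diff (Mb := 0) f0 _ (le_tsum f0 lef))//; first by rewrite [X in _ - X]tsum_eq0 ?subr0.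
  by move=> S _; rewrite big1.
by apply/funext => y; rewrite degD -mulrA Re_natM ReMJ subr0 !expr2.
Qed.

Lemma l2_bounded (f : V -> R[i]) : l2 e f ->
  bounded_sums (fun y => D%:R * sqn (f y)) (complex.Re (inner e f f)).
Proof.
move=> l2f; rewrite inner_self_Re//; apply: le_tsum; last exact: l2_lty.
by move=> y; rewrite mulr_ge0// sqn_ge0.
Qed.

Lemma inner_self_Im (f : V -> R[i]) : complex.Im (inner e f f) = 0.
Proof.
by apply: real_sum0 => y; rewrite -mulrA Im_natM ImMJ [X in X - _]mulrC subrr mulr0.
Qed.

(** Formally, 2 <Q f, f> is the sum of |f(y) + f(z)|^2 over ordered edges; the left side keeps
    finitely many [y] and the real parts only. *)
Lemma Q_op_energy (f : V -> R[i]) (S : seq V) : l2 e f -> uniq S ->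
  \sum_(y <- S) \sum_(z <- nbrs y) (complex.Re (f y) + 1 * complex.Re (f z)) ^+ 2 <=
  2 * complex.Re (inner e (Q_op e f) f).
Proof.
move=> l2f uS.
have hf := l2_bounded l2f; set M := complex.Re (inner e f f) in hf.
pose ed y := \sum_(z <- nbrs y) sqn (f y + f z).
pose nb y := \sum_(z <- nbrs y) sqn (f z).
have D0 : (0 : R) < D%:R by rewrite ltr0n.
have ed0 y : 0 <= ed y by apply: sumr_ge0 => z _; exact: sqn_ge0.
have nb0 y : 0 <= nb y by apply: sumr_ge0 => z _; exact: sqn_ge0.
have nbM : bounded_sums nb M.
  move=> T uT; have h : bounded_sums (fun y => sqn (f y)) (M / D%:R).
    by move=> T' uT'; rewrite ler_pdivlMr// mulrC mulr_sumr hf.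
  have := sum_neighbours_le simple_e.1 finN degD (fun y => sqn_ge0 (f y)) h uT.
  by rewrite mulrCA mulfV ?gt_eqF// mulr1.
(* The summand of Re <Q f, f> is [a y - b y]. The excess D |f|^2 / 2 in [a] sums to M / 2 and
   offsets the sum of [b], which is at most M / 2. *)
pose a y := (ed y + D%:R * sqn (f y)) / 2; pose b y := nb y / 2.
have a0 y : 0 <= a y.
  by rewrite divr_ge0// addr_ge0// mulr_ge0// sqn_ge0.
have b0 y : 0 <= b y by rewrite divr_ge0.
have bM : bounded_sums b (M / 2).
  by move=> T uT; rewrite -mulr_suml ler_pM2r// nbM.
have edle y : ed y <= 2 * (D%:R * sqn (f y)) + 2 * nb y.
  have -> : D%:R * sqn (f y) = \sum_(z <- nbrs y) sqn (f y).
    rewrite big_const_seq count_predT iter_addr_0 mulr_natl.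
    by have := degD y; rewrite /degree => ->.
  rewrite /nb !mulr_sumr -big_split /=; apply: ler_sum => z _.
  rewrite ReD ImD.
  have := sqr_ge0 (complex.Re (f y) - complex.Re (f z)).
  have := sqr_ge0 (complex.Im (f y) - complex.Im (f z)).
  lra.
have aM : bounded_sums a (5 / 2 * M).
  move=> T uT; rewrite /a -mulr_suml big_split /=.
  have : \sum_(y <- T) ed y <= \sum_(y <- T) (2 * (D%:R * sqn (f y)) + 2 * nb y).
    by apply: ler_sum => y _; exact: edle.
  rewrite big_split /= -!mulr_sumr => h.
  have := hf T uT; have := nbM T uT; rewrite -!mulr_sumr; lra.
have -> : complex.Re (inner e (Q_op e f) f) = real_sum (fun y => a y - b y).
  congr real_sum; apply/funext => y.
  rewrite -mulrA Re_natM degD /Q_op /transition_op degD ReMJ ReD ImD.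
  have DK (c : R) : D%:R * (D%:R^-1 * c) = c by rewrite mulrA mulfV ?gt_eqF// mul1r.
  have -> : (D%:R^-1 : R[i]) = (D%:R^-1)%:C by rewrite fmorphV rmorph_nat.
  have RZ (c : R) (z : R[i]) : complex.Re (c%:C * z) = c * complex.Re z.
    by case: z => u v /=; ring.
  have IZ (c : R) (z : R[i]) : complex.Im (c%:C * z) = c * complex.Im z.
    by case: z => u v /=; ring.
  rewrite RZ IZ Re_sum Im_sum /a /b /ed /nb.
  have -> : \sum_(z <- nbrs y) sqn (f y + f z) = D%:R * sqn (f y) +
      \sum_(z <- nbrs y) sqn (f z) + 2 * (complex.Re (f y) * \sum_(z <- nbrs y) complex.Re (f z)
      + complex.Im (f y) * \sum_(z <- nbrs y) complex.Im (f z)).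
    have -> : D%:R * sqn (f y) = \sum_(z <- nbrs y) sqn (f y).
      rewrite big_const_seq count_predT iter_addr_0 mulr_natl.
      by have := degD y; rewrite /degree => ->.
    rewrite !mulr_sumr -[X in 2 * X]big_split /= mulr_sumr -!big_split /=; apply: eq_bigr => z _.
    by rewrite ReD ImD; ring.
  move: (\sum_(z <- _) complex.Re _) (\sum_(z <- _) complex.Im _) => sr si.
  rewrite !mulrDl !mulrDr -!mulrA !DK.
  by field.
rewrite (real_sum_diff a0 b0 aM bM).
set ta := fine _; set tb := fine _.
have tbM : tb <= M / 2 by apply: tsum_le.
have taS : (\sum_(y <- S) ed y) / 2 + M / 2 <= ta.
  have finA : (\esum_(y in [set: V]) (a y)%:E < +oo)%E.
    exact: le_lt_trans (esum_le_bound aM) (ltry _).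
  have ha := le_tsum a0 finA.
  (* [M] is a supremum over finite [T]; the union with [S] lets one finite sum of [a] account for
     both terms. *)
  have : M <= 2 * ta - \sum_(y <- S) ed y.
    have f0 y : 0 <= D%:R * sqn (f y) by rewrite mulr_ge0// sqn_ge0.
    rewrite /M inner_self_Re//.
    apply: tsum_le => // T uT.
    pose U := undup (S ++ T).
    have uU : uniq U by rewrite undup_uniq.
    have h1 : \sum_(y <- T) D%:R * sqn (f y) <= \sum_(y <- U) D%:R * sqn (f y).
      by apply: ler_sum_sub => // y yT; rewrite mem_undup mem_cat yT orbT.
    have h2 : \sum_(y <- S) ed y <= \sum_(y <- U) ed y.
      by apply: ler_sum_sub => // y yT; rewrite mem_undup mem_cat yT.
    have := ha U uU; rewrite -/ta /a -mulr_suml big_split /=; lra.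
  lra.
have : \sum_(y <- S) \sum_(z <- nbrs y) (complex.Re (f y) + 1 * complex.Re (f z)) ^+ 2 <=
       \sum_(y <- S) ed y.
  apply: ler_sum => y _; apply: ler_sum => z _.
  by rewrite mul1r ReD lerDl sqr_ge0.
lra.
Qed.

Lemma unit_vector_l2 (x : V) : l2 e (unit_vector e x : V -> R[i]).
Proof.
rewrite /l2 l2E (esum_pred1 (x := x)) ?ltry// => y.
  by rewrite mulr_ge0// sqn_ge0.
by move=> yx; rewrite /unit_vector (negbTE yx) /= expr0n addr0 mulr0.
Qed.

Lemma inner_unit_vector_Re (f : V -> R[i]) (x : V) :
  complex.Re (inner e f (unit_vector e x)) = Num.sqrt D%:R * complex.Re (f x).
Proof.
rewrite /inner /= (@real_sum_pred1 _ _ _ x) => [|y yx]; last first.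
  by rewrite /unit_vector (negbTE yx) rmorph0 mulr0.
rewrite degD -mulrA Re_natM ReMJ /unit_vector eqxx degD /= mulr0 addr0.
have sD : Num.sqrt D%:R != 0 :> R by rewrite gt_eqF// sqrtr_gt0 ltr0n.
by rewrite -{1}(@sqr_sqrtr R D%:R)// expr2 -mulrA mulrCA [_ * (_ / _)]mulrC mulfVK// mulrC.
Qed.

(** For the projected vector [f], the number m = <f, f> is also sqrt(D) f(x), and the energy of [f]
    is at most delta m. The inequality at [x] then reduces to m^2 <= 64 delta. *)
Lemma vertex_spectral_measure_le
    (E : set (measurableTypeR R) -> (V -> R[i]) -> (V -> R[i])) (x : V) (delta : R) :
  connected_graph e -> ~ bipartite e -> resolution_of_identity e (Q_op e) E ->
  0 <= delta -> vertex_spectral_measure e E x delta <= (8 * Num.sqrt delta)%:C.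
Proof.
move=> conn_e nonbip_e HE d0.
pose B : set (measurableTypeR R) := `[0, delta]%classic.
have mB : measurable B by exact: measurable_itv.
have mBC : measurable (~` B) by exact: measurableC.
pose u : V -> R[i] := unit_vector e x; have l2u := unit_vector_l2 x : l2 e u.
have projB := roi_projection HE mB.
pose f := E B u; have l2f : l2 e f := oproj_l2 projB l2u.
have EBf : E B f = f by apply/funext => y; exact: (oproj_idem projB l2u).
have vsmE : vertex_spectral_measure e E x delta = inner e f f.
  rewrite /vertex_spectral_measure -/B -/u -/f -{1}EBf.
  by rewrite (oproj_selfadjoint projB l2f l2u).
pose m := complex.Re (inner e f f).
have innerE : inner e f f = m%:C.
  by apply/eqP; rewrite eq_complex inner_self_Im !eqxx.
rewrite vsmE innerE lecR.
have hf := l2_bounded l2f; rewrite -/m in hf.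
have m0 : 0 <= m by have := hf [::] isT; rewrite big_nil.
have fx : Num.sqrt D%:R * complex.Re (f x) = m.
  by rewrite -inner_unit_vector_Re -[RHS]/(complex.Re (inner e f f)) -vsmE.
have energy : complex.Re (inner e (Q_op e f) f) <= delta * m.
  have [mu [muE intE]] := roi_integral HE l2f.
  rewrite -lee_fin -intE EFinM.
  have -> : (m%:E = mu B)%E by rewrite muE// EBf.
  apply: integral_id_le => //; rewrite muE//.
  (* The spectral measure of [f] is carried by [B]: E(~B) E(B) is the projection of the empty
     set. *)
  have -> : E (~` B) f = (fun=> 0).
    apply/funext => y; rewrite /f -(roi_setI HE mBC mB l2u) setICl.
    exact: (roi_set0 HE l2u).
  by congr EFin; apply: real_sum0 => y; rewrite mulr0 mul0r.
have D0 : (0 : R) < D%:R by rewrite ltr0n.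
(* The inequality is applied to the real part of [f], which retains the value at [x] while norm and
   energy do not grow. Dividing by [D] removes the degree weight of the inner product. *)
have gn : complex.Re (f x) ^+ 4 <= 64 * (m / D%:R) * (delta * m / D%:R).
  apply: (gagliardo_nirenberg (D := D) (s := 1) (g := fun y => complex.Re (f y))
            x simple_e finN degD conn_e (expr1n _ _)) => [|S uS|S uS].
  - exact: nonbipartite_bad_edge.
  - rewrite ler_pdivlMr// mulrC mulr_sumr; apply: le_trans (hf S uS).
    by apply: ler_sum => y _; rewrite ler_wpM2l// lerDl sqr_ge0.
  - apply: le_trans (Q_op_energy l2f uS) _.
    by rewrite ler_pM2l// [D%:R * _]mulrC divfK// gt_eqF.
have [->|mn0] := eqVneq m 0; first by rewrite mulr_ge0// sqrtr_ge0.
have mp : 0 < m by rewrite lt0r mn0.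
rewrite -(@ler_pXn2r _ 2) ?nnegrE ?mulr_ge0 ?sqrtr_ge0// exprMn sqr_sqrtr//.
have m4 : m ^+ 4 = D%:R ^+ 2 * complex.Re (f x) ^+ 4.
  by rewrite -fx exprMn -[4%N]/(2 * 2)%N (exprM (Num.sqrt _)) sqr_sqrtr.
have : m ^+ 4 <= D%:R ^+ 2 * (64 * (m / D%:R) * (delta * m / D%:R)).
  by rewrite m4 ler_wpM2l// sqr_ge0.
have -> : D%:R ^+ 2 * (64 * (m / D%:R) * (delta * m / D%:R)) = m ^+ 2 * (8 ^+ 2 * delta).
  by field; rewrite gt_eqF.
by rewrite -[m ^+ 4]/(m ^+ (2 + 2)) exprD ler_pM2l// exprn_gt0.
Qed.

End VertexSpectralMeasure.

Unset Implicit Arguments.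

Theorem theorem1p2 (R : realType) (V : choiceType) (e : rel V)
    (simple_e : simple_graph e) (regular_e : regular_graph e)
    (connected_e : connected_graph e) (nonbipartite_e : ~ bipartite e) :
  [/\ forall E : set (measurableTypeR R) -> (V -> R[i]) -> (V -> R[i]),
        resolution_of_identity e (Q_op e) E ->
        forall (x : V) (delta : R), 0 <= delta <= 2 ->
        vertex_spectral_measure e E x delta <= (10 * Num.sqrt delta)%:C,
      forall (x : V) (t : nat), (1 <= t)%N -> ~~ odd t ->
        0 <= walk_prob R e t x x - stationary R e x <= 18 / Num.sqrt t%:R,
      forall (x : V) (t : nat), (1 <= t)%N -> odd t ->
        `|walk_prob R e t x x - stationary R e x| <= 9 / Num.sqrt t%:R
    & forall (n : nat) (v : 'I_n -> V), bijective v ->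
        forall lam : seq R, sorted_eigenvalues (transition_mx e v) lam ->
        forall k : nat, (1 <= k <= n)%N ->
        -1 + k%:R ^+ 2 / (100 * n%:R ^+ 2) <= lam`_k.-1].
Proof.
have [finN [D degD]] := regular_e.
(* A non-bipartite graph has an edge, as one sees with the zero function. *)
have D_gt0 : (0 < D)%N.
  have [y [z [yz _]]] := nonbipartite_bad_edge (fun=> 0 : R) nonbipartite_e.
  by rewrite -(degD y) cardfs_gt0; apply/fset0Pn; exists z; rewrite mem_nbrs.
split.
- move=> E HE x delta /andP[d0 _].
  apply: le_trans (vertex_spectral_measure_le simple_e finN degD D_gt0 x
    connected_e nonbipartite_e HE d0) _.
  by rewrite lecR ler_wpM2r ?sqrtr_ge0// ler_nat.
- move=> x t t0 evt.
  have [a [b [/andP[a0 ha] /andP[b0 hb] ->]]] :=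
    return_prob_decomposition (R := R) simple_e finN degD D_gt0 connected_e nonbipartite_e x t0.
  rewrite -signr_odd (negbTE evt) mul1r addr_ge0//=; lra.
- move=> x t t0 odt.
  have [a [b [/andP[a0 ha] /andP[b0 hb] ->]]] :=
    return_prob_decomposition (R := R) simple_e finN degD D_gt0 connected_e nonbipartite_e x t0.
  (* For odd [t] the two parts are subtracted, and the difference of two numbers in [0, 9 / sqrt t]
     stays within that bound. *)
  rewrite -signr_odd odt mulN1r ler_norml; lra.
- move=> n v bij_v lam lamP k kn.
  exact: eigenvalue_lower_bound lamP kn.
Qed.
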